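(* For every integer $k\geq 2$, $$5\cdot 2^{k-3}+1\;\geq\; n_d(C_2^k)\;\geq\;\begin{cases}\frac{k(k+1)}{2} & \text{if } k\geq 2 \text{ is even},\\[2pt] \frac{k(k+1)}{2}-1 & \text{if } k\geq 3 \text{ is odd},\end{cases}$$ where $n_d(C_2^k)$ is the diagonal Vasquez invariant of the elementary abelian $2$-group $C_2^k$ of rank $k$.
   Context: An $n$-dimensional crystallographic group is a discrete cocompact subgroup $\Gamma$ of $\mathrm{Isom}(\mathbb{E}^n)=O(n)\ltimes\mathbb{R}^n$. Its lattice subgroup is $\Gamma\cap\mathbb{R}^n\cong\mathbb{Z}^n$, a maximal abelian normal subgroup of finite index; its holonomy group is the finite group $G=\Gamma/(\Gamma\cap\mathbb{R}^n)$, and the conjugation action of $G$ on the lattice subgroup is the (faithful) holonomy representation $\rho:G\to\mathrm{GL}_n(\mathbb{Z})$. A Bieberbach group is a torsion-free crystallographic group. A crystallographic group is of diagonal type if it is isomorphic to a crystallographic group whose holonomy representation is diagonal (equivalently, the lattice subgroup has a $\mathbb{Z}$-basis $e_1,\dots,e_n$ with $g\cdot e_i=\pm e_i$ for all $g\in G$ and all $i$); then $G$ is an elementary abelian $2$-group. Diagonal Vasquez invariant: for an elementary abelian $2$-group $G$, $n_d(G)$ is the smallest integer with the property that for every Bieberbach group $\Gamma$ of diagonal type with holonomy group isomorphic to $G$, the lattice subgroup of $\Gamma$ contains a subgroup $N$, normal in $\Gamma$, such that $\Gamma/N$ is a Bieberbach group of diagonal type of dimension at most $n_d(G)$. $C_2$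 is the cyclic group of order $2$. *)

(* Defs.v *)
From HB Require Import structures.
From mathcomp Require Import all_boot all_order all_algebra all_fingroup.
From mathcomp Require Import all_classical all_reals all_analysis.

Set Implicit Arguments.
Unset Strict Implicit.
Unset Printing Implicit Defensive.

Import Order.TTheory GRing.Theory Num.Theory.
Import numFieldNormedType.Exports.

Local Open Scope classical_set_scope.
Local Open Scope ring_scope.

Section AbstractGroups.

Definition subgroup (G : groupType) (H : set G) : Prop :=
  [/\ H 1%g, forall x y, H x -> H y -> H (x * y)%g & forall x, H x -> H x^-1%g].

Definition normal_in (G : groupType) (N H : set G) : Prop :=
  forall g x, H g -> N x -> N (g * x * g^-1)%g.

Definition torsion_free (G : groupType) (H : set G) : Prop :=
  forall x m, H x -> (0 < m)%N -> (x ^+ m = 1)%g -> x = 1%g.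

Definition setmulg (G : groupType) (A B : set G) : set G :=
  [set (x * y)%g | x in A & y in B].

(* The carrier of [H / N], a set of cosets; for [N] normal in [H] its group
   law is [setmulg]. *)
Definition cosets (G : groupType) (H N : set G) : set (set G) :=
  [set [set (g * x)%g | x in N] | g in H].

(* A group is here a set of elements of [T], with a product on [T]. *)
Definition isomorphic (T U : Type) (A : set T) (mulT : T -> T -> T)
    (B : set U) (mulU : U -> U -> U) : Prop :=
  exists2 f : T -> U, set_bij A B f &
    forall x y, A x -> A y -> f (mulT x y) = mulU (f x) (f y).

End AbstractGroups.

Section Isometries.
Context {R : realType} {n : nat}.

(* [MkIsom (A, a)] is the isometry [x |-> A x + a]. *)
Record Isom := MkIsom {
  isom_val :> 'M[R]_n * 'cV[R]_n;
  isom_orthogonal : isom_val.1^T *m isom_val.1 == 1%:M }.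

HB.instance Definition _ := [isSub for isom_val].
HB.instance Definition _ := [Choice of Isom by <:].

Implicit Types g h : Isom.

Fact isom_one_subproof : (1%:M : 'M[R]_n)^T *m 1%:M == 1%:M.
Proof. by rewrite trmx1 mul1mx. Qed.

Fact isom_mul_subproof g h : (g.1 *m h.1)^T *m (g.1 *m h.1) == 1%:M.
Proof.
rewrite trmx_mul mulmxA -[_ *m g.1]mulmxA (eqP (isom_orthogonal g)) mulmx1.
exact: isom_orthogonal.
Qed.

Fact isom_inv_subproof g : g.1^T^T *m g.1^T == 1%:M.
Proof. by rewrite trmxK (mulmx1C (eqP (isom_orthogonal g))). Qed.

Definition isom_one : Isom := @MkIsom (_, 0) isom_one_subproof.
Definition isom_mul g h : Isom :=
  @MkIsom (_, g.1 *m h.2 + g.2) (isom_mul_subproof g h).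
Definition isom_inv g : Isom :=
  @MkIsom (_, - (g.1^T *m g.2)) (isom_inv_subproof g).

Fact isom_mulA : associative isom_mul.
Proof.
move=> f g h; apply: val_inj => /=.
by rewrite mulmxA mulmxDr mulmxA addrA.
Qed.

Fact isom_mul1 : left_id isom_one isom_mul.
Proof. by move=> [[A a] i]; apply: val_inj; rewrite /= !mul1mx addr0. Qed.

Fact isom_1mul : right_id isom_one isom_mul.
Proof. by move=> [[A a] i]; apply: val_inj; rewrite /= mulmx1 mulmx0 add0r. Qed.

Fact isom_mulV : left_inverse isom_one isom_inv isom_mul.
Proof.
move=> g; apply: val_inj => /=.
by rewrite (eqP (isom_orthogonal g)) subrr.
Qed.

Fact isom_Vmul : right_inverse isom_one isom_inv isom_mul.
Proof.
move=> g; apply: val_inj => /=.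
by rewrite mulmxN mulmxA (mulmx1C (eqP (isom_orthogonal g))) mul1mx addNr.
Qed.

HB.instance Definition _ :=
  isGroup.Build Isom isom_mulA isom_mul1 isom_1mul isom_mulV isom_Vmul.

HB.instance Definition _ := Topological.copy Isom (initial_topology isom_val).

Definition isom_act g (x : 'cV[R]_n) : 'cV[R]_n := g.1 *m x + g.2.

Definition translation (a : 'cV[R]_n) : Isom := @MkIsom (_, a) isom_one_subproof.

End Isometries.

Arguments Isom : clear implicits.

Section OrbitSpace.
Local Open Scope quotient_scope.
Context {R : realType} {n : nat} (Gamma : set (Isom R n)).

Definition orbit_of (x : 'cV[R]_n) : set 'cV[R]_n :=
  [set isom_act g x | g in Gamma].

(* Stated as equality of orbits, so that it is an equivalence relation without
   assuming [Gamma] to be a subgroup. *)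
Definition same_orbit : rel 'cV[R]_n :=
  fun x y => `[< orbit_of x = orbit_of y >].

Fact same_orbit_refl : reflexive same_orbit.
Proof. by move=> x; apply/asboolP. Qed.

Fact same_orbit_sym : symmetric same_orbit.
Proof. by move=> x y; apply/asboolP/asboolP. Qed.

Fact same_orbit_trans : transitive same_orbit.
Proof. by move=> y x z /asboolP xy /asboolP yz; apply/asboolP; rewrite xy. Qed.

Definition orbit_equiv : equiv_rel 'cV[R]_n :=
  EquivRel same_orbit same_orbit_refl same_orbit_sym same_orbit_trans.

Definition orbit_space : topologicalType :=
  quotient_topology {eq_quot orbit_equiv}.

End OrbitSpace.

Section CrystallographicGroups.
Context {R : realType}.

Definition discrete n (Gamma : set (Isom R n)) : Prop :=
  Gamma `<=` isolated Gamma.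

Definition cocompact n (Gamma : set (Isom R n)) : Prop :=
  compact [set: orbit_space Gamma].

Definition crystallographic n (Gamma : set (Isom R n)) : Prop :=
  [/\ subgroup Gamma, discrete Gamma & cocompact Gamma].

Definition bieberbach n (Gamma : set (Isom R n)) : Prop :=
  crystallographic Gamma /\ torsion_free Gamma.

Definition lattice n (Gamma : set (Isom R n)) : set (Isom R n) :=
  Gamma `&` range translation.

Definition lattice_coord n (E : 'M[R]_n) (z : 'cV[int]_n) : Isom R n :=
  translation (E *m map_mx intr z).

(* The columns of [E] form a Z-basis of the lattice subgroup. *)
Definition lattice_basis n (Gamma : set (Isom R n)) (E : 'M[R]_n) : Prop :=
  set_bij setT (lattice Gamma) (lattice_coord E).

(* [M] is the matrix, in the basis [E], of the conjugation action of [g] on the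
   lattice subgroup, i.e. the value of the holonomy representation at the
   class of [g]. *)
Definition holonomy_mx n (E : 'M[R]_n) (g : Isom R n) (M : 'M[int]_n) : Prop :=
  forall z, (g * lattice_coord E z * g^-1)%g = lattice_coord E (M *m z).

Definition diagonal_holonomy n (Gamma : set (Isom R n)) : Prop :=
  exists2 E : 'M[R]_n, lattice_basis Gamma E &
    forall g, Gamma g -> exists2 M, holonomy_mx E g M & is_diag_mx M.

Definition diagonal_type n (Gamma : set (Isom R n)) : Prop :=
  exists m (Delta : set (Isom R m)),
    [/\ crystallographic Delta, diagonal_holonomy Delta &
        isomorphic Gamma *%g Delta *%g].

Definition holonomy_isog n (Gamma : set (Isom R n))
    (gT : finGroupType) (G : {group gT}) : Prop :=
  isomorphic (cosets Gamma (lattice Gamma)) (@setmulg _) [set` G] *%g.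

(* The quotient [Gamma / N] is a Bieberbach group of diagonal type of
   dimension [m]. *)
Definition diagonal_bieberbach_quotient n (Gamma N : set (Isom R n)) (m : nat)
    : Prop :=
  exists Delta : set (Isom R m),
    [/\ bieberbach Delta, diagonal_type Delta &
        isomorphic (cosets Gamma N) (@setmulg _) Delta *%g].

End CrystallographicGroups.

Section VasquezInvariant.
Variables (R : realType) (gT : finGroupType) (G : {group gT}).

Definition vasquez_bound (d : nat) : Prop :=
  forall n (Gamma : set (Isom R n)),
    bieberbach Gamma -> diagonal_type Gamma -> holonomy_isog Gamma G ->
    exists N : set (Isom R n),
      [/\ subgroup N, N `<=` lattice Gamma, normal_in N Gamma &
          exists2 m, (m <= d)%N & diagonal_bieberbach_quotient Gamma N m].

(* The minimum is a relation: [d] is the diagonal Vasquez invariant of [G]. *)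
Definition is_diagonal_vasquez (d : nat) : Prop :=
  vasquez_bound d /\ forall d', vasquez_bound d' -> (d <= d')%N.

End VasquezInvariant.

(* Main.v *)
(** A group of diagonal type is determined by homomorphisms
    chi_i, beta_i : C_2^k -> F_2, one pair per coordinate of the lattice: g acts
    on coordinate i by the sign (-1)^(chi_i g) followed by a shift by
    (beta_i g)/2.  It is torsion free iff every g <> 0 is covered by some i, i.e.
    chi_i g = 0 and beta_i g = 1, and its holonomy is C_2^k iff the chi_i have no
    common zero.  The quotients by normal subgroups of the lattice that matter
    arise by dropping coordinates and by adding up two coordinates with the same
    character.

    Upper bound.  In a minimal system each coordinate i either has a private
    vector, covered by i alone, or is the only one to detect some vector of C_2^k.
    The covering functions (1 + chi_i) beta_i are quadratic polynomials on F_2^k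
    without constant term, and private vectors make them linearly independent.
    With a correction for the coordinates of the second kind there are at most
    k(k+1)/2 + 1 coordinates; ranks 2 and 3 need a closer look.

    Lower bound.  There are systems with k(k+1)/2 (for k = 3: 5) coordinates which
    have a private vector and a character shared with no other coordinate.  A
    normal subgroup of the lattice with torsion free quotient then avoids these
    coordinates, so that the quotient contains a free abelian group of that rank;
    by counting lattice points, a discrete group of isometries of R^m contains no
    free abelian group of rank greater than m. *)
Require Import Defs.
From mathcomp Require Import all_boot all_order all_algebra all_fingroup.
From mathcomp Require Import all_classical all_reals all_analysis.
From mathcomp Require Import zify ring lra.

Set Implicit Arguments.
Unset Strict Implicit.
Unset Printing Implicit Defensive.

Import Order.TTheory GRing.Theory Num.Theory.
Import numFieldNormedType.Exports.

Local Open Scope classical_set_scope.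
Local Open Scope ring_scope.

(** * Topology of the isometry group and of the orbit space *)

Lemma isom_eq (R : realType) n (g h : Isom R n) : g.1 = h.1 -> g.2 = h.2 -> g = h.
Proof.
move=> e1 e2; apply: val_inj.
by rewrite [LHS]surjective_pairing e1 e2 -surjective_pairing.
Qed.

(** [Isom] carries the initial topology of the pair of matrix and vector, and balls of such pairs
    are entrywise. *)
Lemma isolated_entries (R : realType) n (Gamma : set (Isom R n)) (x : Isom R n) :
  isolated Gamma x -> exists2 e : R, 0 < e & forall y, Gamma y ->
    (forall i j, `|x.1 i j - y.1 i j| < e) ->
    (forall i, `|x.2 i 0 - y.2 i 0| < e) -> y = x.
Proof.
move=> [_ [V nV VG]]; move: nV; rewrite nbhsE => -[U [oU Ux] UV].
case: oU => A oA AU; subst U.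
have /nbhs_ballP[e /= e0 eA] : nbhs (isom_val x) A by exact: open_nbhs_nbhs.
exists e => // y Gy y1 y2.
have : (V `&` Gamma) y.
  split=> //; apply: UV; apply: eA; split.
    by split=> // i j; exact: y1.
  by split=> // i j; rewrite [j]ord1; exact: y2.
by rewrite VG.
Qed.

Lemma entries_isolated (R : realType) n (Gamma : set (Isom R n)) (x : Isom R n) (e : R) :
  0 < e -> Gamma x -> (forall y, Gamma y ->
    (forall i j, `|x.1 i j - y.1 i j| < e) ->
    (forall i, `|x.2 i 0 - y.2 i 0| < e) -> y = x) ->
  isolated Gamma x.
Proof.
move=> e0 Gx H; split; first by rewrite inE.
exists (@isom_val R n @^-1` ball (isom_val x) e).
  have := @initial_continuous _ _ (@isom_val R n) x.
  by apply; exact: nbhsx_ballx.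
apply/seteqP; split=> y /=.
  move=> [[[_ y1] [_ y2]] Gy]; apply: H => //; move=> i; exact: y2.
move=> ->; split=> //; exact: ballxx.
Qed.

(** Every orbit meets the unit cube, so the orbit space is a continuous image of a compact set. *)
Lemma orbit_space_compact (R : realType) n (Gamma : set (Isom R n)) :
  subgroup Gamma ->
  (forall x : 'cV[R]_n, exists2 g, Gamma g & forall i, 0 <= isom_act g x i 0 <= 1) ->
  cocompact Gamma.
Proof.
move=> [G1 GM GV] cov; rewrite /cocompact.
(* Row vectors, to fit [rV_compact]; hence the transpose. *)
pose f (v : 'rV[R]_n) : orbit_space Gamma := \pi_(orbit_space Gamma)%qT v^T.
have -> : [set: orbit_space Gamma] = f @` [set v : 'rV[R]_n | forall i, `[0, 1]%classic (v ord0 i)].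
  apply/seteqP; split=> // q _ /=.
  rewrite -[q]generic_quotient.reprK; set x := generic_quotient.repr q.
  have [g Gg gx] := cov x.
  exists (isom_act g x)^T.
    by move=> i /=; rewrite in_itv /= mxE.
  rewrite /f trmxK; apply/generic_quotient.eqmodP/asboolP.
  have actM h h' : isom_act h (isom_act h' x) = isom_act (h * h')%g x.
    by rewrite /isom_act /= mulmxDr mulmxA addrA.
  apply/seteqP; split=> _ [h Gh <-].
    by exists (h * g)%g; [exact: GM | rewrite actM].
  exists (h * g^-1)%g; first by apply: GM => //; exact: GV.
  by rewrite actM -mulgA mulVg mulg1.
apply: continuous_compact; last first.
  have /(rV_compact (n := n)) : forall i : 'I_n, compact (`[0, 1]%classic : set R).
    by move=> i; exact: segment_compact.
  exact.
apply: continuous_subspaceT => v; apply: continuous_comp; last exact: pi_continuous.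
move=> A /nbhs_ballP[e /= e0 eA]; apply/nbhs_ballP; exists e => //= y [_ yv].
by apply: eA; split=> // i j; rewrite !mxE; exact: yv.
Qed.

(** An invariant continuous function descends to the compact orbit space and is bounded there. *)
Lemma cocompact_bounded (R : realType) n (Gamma : set (Isom R n)) (H : 'cV[R]_n -> R) :
  subgroup Gamma -> cocompact Gamma -> continuous H ->
  (forall g x, Gamma g -> H (isom_act g x) = H x) ->
  exists M, forall x, `|H x| <= M.
Proof.
move=> [G1 GM GV] cG cH invH.
pose h : orbit_space Gamma -> R := H \o generic_quotient.repr.
have Heq (x y : 'cV[R]_n) : orbit_of Gamma x = orbit_of Gamma y -> H x = H y.
  move=> xy; have : orbit_of Gamma x x by exists 1%g => //; rewrite /isom_act mul1mx addr0.
  by rewrite xy => -[g Gg <-]; rewrite invH.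
have ch : continuous h.
  apply: repr_comp_continuous => // x y /eqP/generic_quotient.eqmodP/asboolP xy.
  by apply/eqP/Heq.
have : compact (h @` [set: orbit_space Gamma]).
  by apply: continuous_compact => //; apply: continuous_subspaceT.
(* [compact_bounded] gives the bound for every number above M, hence M + 1. *)
move=> /compact_bounded[M [_ Mh]]; exists (M + 1) => x.
have -> : H x = h (\pi_(orbit_space Gamma)%qT x).
  apply: Heq; apply/asboolP; rewrite -/(same_orbit _ _ _).
  by apply/(@generic_quotient.eqmodP _ (orbit_equiv Gamma)); rewrite generic_quotient.reprK.
apply: Mh; first by rewrite ltrDl.
by exists (\pi_(orbit_space Gamma)%qT x).
Qed.

(** * Ranks of discrete groups *)

(* A point of [-C, C] is located up to d by the integer part of (x + C) / d. *)
Lemma truncn_close (R : realType) (C d x y : R) : 0 < d -> `|x| <= C -> `|y| <= C ->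
  Num.truncn ((x + C) / d) = Num.truncn ((y + C) / d) -> `|x - y| < d.
Proof.
move=> d0 xC yC e.
have ge0 (z : R) : `|z| <= C -> 0 <= (z + C) / d.
  by rewrite ler_norml => /andP[z1 _]; apply: divr_ge0; lra.
have := truncn_itv (ge0 _ xC); have := truncn_itv (ge0 _ yC).
rewrite -e; set t := Num.truncn _; rewrite -natr1.
rewrite !ler_pdivlMr // !ltr_pdivrMr // ltr_norml.
by move=> /andP[? ?] /andP[? ?]; apply/andP; split; lra.
Qed.

Lemma truncn_bound (R : realType) (C d x : R) (K : nat) : 0 < d -> `|x| <= C ->
  2 * C / d <= K%:R -> (Num.truncn ((x + C) / d) < K.+1)%N.
Proof.
move=> d0; rewrite ler_norml => /andP[x1 x2] CK.
have h0 : 0 <= (x + C) / d by apply: divr_ge0; lra.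
rewrite ltnS -(ler_nat R); apply: le_trans CK.
have /andP[h _] := truncn_itv h0; apply: le_trans h _.
by rewrite ler_pM2r ?invr_gt0 //; lra.
Qed.

(* A box of side N has (N+1)^r integer points; their images are separated and lie
   in a region that is only covered by O(N^q) cells. *)
Lemma separated_rank_le (R : realType) (P : finType) (r q : nat)
    (f1 : ('I_r -> nat) -> P -> R) (f2 : ('I_r -> nat) -> 'I_q -> R) (B C d : R) :
  0 < d -> (forall z i, `|f1 z i| <= B) ->
  (forall z N, (forall i, (z i <= N)%N) -> forall i, `|f2 z i| <= C * N%:R) ->
  (forall z z', (forall i, `|f1 z i - f1 z' i| < d) ->
     (forall i, `|f2 z i - f2 z' i| < d) -> z =1 z') ->
  (r <= q)%N.
Proof.
move=> d0 b1 b2 sep.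
have ex_nat (x : R) : exists K : nat, x <= K%:R.
  by exists (Num.truncn x).+1; apply: ltW; exact: truncnS_gt.
have [K hK] := ex_nat (2 * B / d); have [L hL] := ex_nat (2 * C / d).
have count N : ((N.+1) ^ r <= K.+1 ^ #|P| * (L * N).+1 ^ q)%N.
  pose ext (z : {ffun 'I_r -> 'I_N.+1}) (i : 'I_r) : nat := z i.
  have hN (z : {ffun 'I_r -> 'I_N.+1}) i : `|f2 (ext z) i| <= C * N%:R.
    by apply: b2 => j; rewrite -ltnS; exact: ltn_ord.
  have hLN : 2 * (C * N%:R) / d <= (L * N)%:R.
    rewrite natrM.
    have -> : 2 * (C * N%:R) / d = 2 * C / d * N%:R by rewrite mulrA mulrAC.
    by apply: ler_wpM2r.
  (* The cells that contain the two images. By [sep] the code is injective, so points are at most as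
     many as cells. *)
  pose code (z : {ffun 'I_r -> 'I_N.+1}) : {ffun P -> 'I_K.+1} * {ffun 'I_q -> 'I_(L * N).+1} :=
    ([ffun i => inord (Num.truncn ((f1 (ext z) i + B) / d))],
     [ffun i => inord (Num.truncn ((f2 (ext z) i + C * N%:R) / d))]).
  have code_inj : injective code.
    move=> z z' [/ffunP e1 /ffunP e2].
    have zz' : ext z =1 ext z'.
      apply: sep => i.
        apply: (truncn_close d0 (b1 _ _) (b1 _ _)).
        move: (e1 i); rewrite !ffunE => /(congr1 val) /=.
        by rewrite !inordK //; apply: truncn_bound.
      apply: (truncn_close d0 (hN _ _) (hN _ _)).
      move: (e2 i); rewrite !ffunE => /(congr1 val) /=.
      by rewrite !inordK //; apply: truncn_bound.
    by apply/ffunP => i; apply: val_inj; exact: zz'.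
  by have := leq_card _ code_inj; rewrite card_prod !card_ffun !card_ord.
rewrite leqNgt; apply/negP => qr.
(* M collects the constants. In the box of side M + 1 there are at least (M+2)^(q+1) points when r >
   q, but at most M (M+1)^q cells. *)
pose M := (K.+1 ^ #|P| * L.+1 ^ q)%N.
have := count M.+1; apply/negP; rewrite -ltnNge.
apply: (@leq_ltn_trans (M * M.+1 ^ q)%N).
  rewrite {2}/M -mulnA leq_mul // -expnMn.
  by case: (posnP q) => [->|q0] //; rewrite leq_exp2r //; nia.
apply: (@leq_trans (M.+1 ^ q.+1)%N).
  by rewrite expnS ltn_mul2r expn_gt0 /=.
apply: (@leq_trans (M.+2 ^ q.+1)%N); first by rewrite leq_exp2r.
by rewrite leq_exp2l.
Qed.

Lemma orthogonal_entry_le1 (R : realType) m (g : Isom R m) i j : `|g.1 i j| <= 1.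
Proof.
have := congr1 (fun M : 'M[R]_m => M j j) (eqP (isom_orthogonal g)).
rewrite !mxE eqxx mulr1n (bigD1 i) //= mxE => e.
have : g.1 i j ^+ 2 <= 1.
  rewrite expr2 -e lerDl; apply: sumr_ge0 => l _; rewrite mxE -expr2; exact: sqr_ge0.
by rewrite -{1}[g.1 i j ^+ 2]ger0_norm ?sqr_ge0 // normrX expr_le1.
Qed.

Lemma mulmx_entry_le (R : realType) m n p (A : 'M[R]_(m, n)) (B : 'M[R]_(n, p)) (a c : R) :
  0 <= a -> (forall i j, `|A i j| <= a) -> (forall i j, `|B i j| <= c) ->
  forall i j, `|(A *m B) i j| <= n%:R * (a * c).
Proof.
move=> a0 Aa Bc i j; rewrite mxE; apply: le_trans (ler_norm_sum _ _ _) _.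
rewrite mulr_natl -[n in _ *+ n]card_ord -sumr_const.
by apply: ler_sum => l _; rewrite normrM; apply: ler_pM.
Qed.

Lemma mulmx_entry_lt (R : realType) m n p (A : 'M[R]_(m, n)) (B : 'M[R]_(n, p)) (a c e : R) :
  0 <= a -> 0 < c -> n%:R * (a * c) < e ->
  (forall i j, `|A i j| <= a) -> (forall i j, `|B i j| < c) ->
  forall i j, `|(A *m B) i j| < e.
Proof.
move=> a0 c0 h Aa Bc i j; apply: le_lt_trans h; apply: mulmx_entry_le => // *.
exact: ltW.
Qed.

Lemma orthogonal_close (R : realType) m n (A : 'M[R]_m) (B : 'M[R]_(m, n)) (e : R) :
  0 < e -> (forall i j, `|A i j| <= 1) -> (forall i j, `|B i j| < e / (m.+1)%:R) ->
  forall i j, `|(A *m B) i j| < e.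
Proof.
move=> e0 Aa Bc; apply: mulmx_entry_lt Aa Bc => //; first by rewrite divr_gt0.
by rewrite mul1r mulrCA gtr_pMr // ltr_pdivrMr // mul1r ltr_nat.
Qed.

Lemma entry_bounded (R : realType) m n (A : 'M[R]_(m, n)) :
  exists2 c : R, 0 <= c & forall i j, `|A i j| <= c.
Proof.
exists (\sum_i \sum_j `|A i j|); first by apply: sumr_ge0 => i _; exact: sumr_ge0.
move=> i j; rewrite (bigD1 i) //= (bigD1 j) //= -addrA lerDl addr_ge0 ?sumr_ge0 //.
by move=> l _; exact: sumr_ge0.
Qed.

(** Orthogonal linear parts are bounded, translation parts grow at most linearly in the exponents,
    and discreteness separates the values: [separated_rank_le] applies with q = m. *)
Lemma discrete_rank_le (R : realType) m (Delta : set (Isom R m)) (V : zmodType)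
    (f : V -> Isom R m) r (b : 'I_r -> V) :
  subgroup Delta -> discrete Delta -> (forall v, Delta (f v)) ->
  {morph f : u v / u + v >-> (u * v)%g} ->
  (forall z : 'I_r -> int, f (\sum_i b i *~ z i) = 1%g -> forall i, z i = 0) ->
  (r <= m)%N.
Proof.
move=> [D1 DM DV] dis fD fM inj.
have [e e0 he] := isolated_entries (dis _ D1).
have f0 : f 0 = 1%g.
  by apply: (@mulgI _ (f 0)); rewrite -fM addr0 mulg1.
have fN v : f (- v) = (f v)^-1%g.
  by apply: (@mulgI _ (f v)); rewrite -fM subrr mulgV f0.
have [c c0 hc'] := entry_bounded (\matrix_(i, j) (f (b i)).2 j 0).
have hc i j : `|(f (b i)).2 j 0| <= c by move: (hc' i j); rewrite mxE.
(* Entries of an orthogonal matrix are at most 1 in absolute value, so a further factor [f v] adds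
   at most m k to each translation coordinate. *)
have step u v C k : (forall j, `|(f u).2 j 0| <= C) -> (forall j, `|(f v).2 j 0| <= k) ->
    forall j, `|(f (u + v)).2 j 0| <= C + m%:R * k.
  move=> hu hv j; rewrite fM /= mxE addrC; apply: le_trans (ler_normD _ _) _.
  apply: lerD => //; rewrite -[k]mul1r; apply: mulmx_entry_le => //.
    exact: orthogonal_entry_le1.
  by move=> l k'; rewrite [k']ord1.
have pow i k j : `|(f (b i *+ k)).2 j 0| <= m%:R * c * k%:R.
  elim: k j => [|k IH] j; first by rewrite mulr0n f0 mxE normr0 mulr0.
  by rewrite mulrSr -natr1 mulrDr mulr1; apply: step.
(* Natural exponents are enough: a coincidence of two of them becomes an integral relation by
   subtraction. *)
pose w (z : 'I_r -> nat) : V := \sum_i b i *+ z i.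
apply: (@separated_rank_le R _ r m (fun z (ij : 'I_m * 'I_m) => (f (w z)).1 ij.1 ij.2)
  (fun z i => (f (w z)).2 i 0) 1 (r%:R * (m%:R * (m%:R * c))) (e / (m.+1)%:R)).
- by rewrite divr_gt0.
- by move=> z [i j]; exact: orthogonal_entry_le1.
- move=> z N hz j; rewrite /w -mulrA mulr_natl -[r in _ *+ r]card_ord -sumr_const.
  rewrite -!mulrA; elim/big_rec2: _ j => [|i y x _ IH] j; first by rewrite f0 mxE normr0.
  rewrite (addrC (b i *+ _)) (addrC (m%:R * _)); apply: step => // l.
  apply: le_trans (pow _ _ _) _; rewrite -!mulrA; apply: ler_wpM2l => //.
  by apply: ler_wpM2l => //; rewrite ler_nat.
move=> z z' h1 h2.
(* Values that are close have a quotient close to 1, and 1 is isolated. *)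
have fww' : ((f (w z))^-1 * f (w z'))%g = 1%g.
  have orth : (f (w z)).1^T *m (f (w z)).1 = 1%:M := eqP (isom_orthogonal _).
  apply: he; first by apply: DM => //; exact: DV.
    move=> i j /=.
    have -> : (1%:M : 'M[R]_m) i j - ((f (w z)).1^T *m (f (w z')).1) i j
        = ((f (w z)).1^T *m ((f (w z)).1 - (f (w z')).1)) i j.
      by rewrite mulmxBr orth !mxE.
    apply: orthogonal_close => // k l; first by rewrite mxE; exact: orthogonal_entry_le1.
    by rewrite !mxE; exact: (h1 (k, l)).
  move=> i /=.
  have -> : (0 : 'cV[R]_m) i 0 -
        ((f (w z)).1^T *m (f (w z')).2 + - ((f (w z)).1^T *m (f (w z)).2)) i 0
        = ((f (w z)).1^T *m ((f (w z)).2 - (f (w z')).2)) i 0.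
    by rewrite mulmxBr !mxE sub0r opprD opprK addrC.
  apply: orthogonal_close => // k l; first by rewrite mxE; exact: orthogonal_entry_le1.
  by rewrite !mxE [l]ord1; exact: h2.
move=> i.
have := inj (fun i => (z' i)%:Z - (z i)%:Z).
have -> : \sum_i b i *~ ((z' i)%:Z - (z i)%:Z) = w z' - w z.
  by rewrite /w -sumrB; apply: eq_bigr => l _; rewrite mulrzBr.
rewrite addrC fM fN fww' => /(_ erefl i) /eqP; rewrite subr_eq0 => /eqP [->] //.
Qed.

(** If the rank q of [E] were below n, the lattice would be a discrete copy of Z^n in dimension q,
    against [separated_rank_le]. *)
Lemma lattice_basis_unit (R : realType) n (Delta : set (Isom R n)) (E : 'M[R]_n) :
  subgroup Delta -> discrete Delta -> lattice_basis Delta E -> E \in unitmx.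
Proof.
move=> [D1 DM DV] dis bE.
have [e e0 he] := isolated_entries (dis _ D1).
have inL z : Delta (lattice_coord E z).
  by have [+ _ _] := bE => /(_ z I) []. 
have injE : injective (lattice_coord E).
  by move=> x y xy; have [_ + _] := bE; apply; rewrite ?inE.
(* [Rb] supplies q coordinates for the lattice points, and [Cb] recovers the points with bounded
   distortion. *)
have [q [Cb [Rb [EE qE]]]] : exists q (Cb : 'M[R]_(n, q)) (Rb : 'M[R]_(q, n)),
    Cb *m Rb = E /\ \rank E = q.
  by exists (\rank E), (col_base E), (row_base E); split=> //; exact: mulmx_base.
have [c c0 hc] := entry_bounded Cb; have [c' c'0 hc'] := entry_bounded Rb.
pose v (z : 'I_n -> nat) : 'cV[int]_n := \col_i (z i)%:Z.
pose d := e / (q.+1%:R * (c + 1)).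
have d0 : 0 < d by rewrite divr_gt0 // mulr_gt0 // ltr_wpDl.
rewrite -row_full_unit /row_full eqn_leq rank_leq_row qE /=.
(* Translations have trivial linear part, so the bounded family is empty, indexed by ['I_0]. *)
apply: (@separated_rank_le R _ n q (fun z (i : 'I_0) => 0)
   (fun z i => (Rb *m map_mx intr (v z)) i 0) 0 (n%:R * c') d d0).
- by move=> z [].
- move=> z N hz i; rewrite -mulrA; apply: mulmx_entry_le => // k l.
  by rewrite !mxE -pmulrn normr_nat ler_nat.
move=> z z' _ h i.
suff : v z' = v z by move=> /matrixP /(_ i 0); rewrite !mxE => -[->].
apply: injE; suff : ((lattice_coord E (v z))^-1 * lattice_coord E (v z'))%g = 1%g.
  by move=> hh; apply: (@mulgI _ (lattice_coord E (v z))^-1%g); rewrite hh mulVg.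
apply: he; first by apply: DM => //; exact: DV.
  by move=> k l /=; rewrite trmx1 mul1mx subrr normr0.
move=> k /=; rewrite trmx1 !mul1mx.
have -> : (0 : 'cV[R]_n) k 0 - (E *m map_mx intr (v z') - E *m map_mx intr (v z)) k 0
  = (Cb *m (Rb *m map_mx intr (v z) - Rb *m map_mx intr (v z'))) k 0.
  rewrite mulmxBr !mulmxA EE.
  set u := E *m _; set u' := E *m _; by rewrite !mxE sub0r opprD opprK addrC.
apply: (@mulmx_entry_lt _ _ _ _ _ _ c d) => //; last first.
  by move=> a b; rewrite [b]ord1 !mxE; have := h a; rewrite !mxE.
have cd : c * d = e / q.+1%:R * (c / (c + 1)).
  by rewrite /d; field; apply/andP; split; rewrite ?pnatr_eq0 // gt_eqF // ltr_wpDl.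
rewrite cd mulrA; apply: le_lt_trans (_ : q%:R * (e / q.+1%:R) < e).
  rewrite ler_piMr //; first by rewrite mulr_ge0 // divr_ge0 // ltW.
  by rewrite ler_pdivrMr ?ltr_wpDl // mul1r lerDl.
by rewrite mulrCA gtr_pMr // ltr_pdivrMr // mul1r ltr_nat.
Qed.

(** First isomorphism theorem for a map that is multiplicative on K only. *)
Lemma kernel_isomorphic (G H : groupType) (K : set G) (B : set H) (f : G -> H) :
  subgroup K -> (forall x y, K x -> K y -> f (x * y)%g = (f x * f y)%g) ->
  (forall x, K x -> B (f x)) -> (forall y, B y -> exists2 x, K x & f x = y) ->
  let N := K `&` [set x | f x = 1%g] in
  [/\ subgroup N, normal_in N K & isomorphic (cosets K N) (@setmulg G) B *%g].
Proof.
move=> [K1 KM KV] fM fB Bf N.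
have f1 : f 1%g = 1%g by apply: (@mulgI _ (f 1%g)); rewrite -fM // !mulg1.
have fV x : K x -> f x^-1%g = (f x)^-1%g.
  by move=> Kx; apply: (@mulgI _ (f x)); rewrite -fM ?mulgV //; exact: KV.
have nN : normal_in N K.
  move=> g x Kg [Kx /= fx]; split; first by exact: (KM _ _ (KM _ _ Kg Kx) (KV _ Kg)).
  by rewrite /= !fM ?fV ?fx ?mulg1 ?mulgV //; [exact: KM | exact: KV].
split=> //.
  split; first by split.
    by move=> x y [Kx /= fx] [Ky /= fy]; split; [exact: KM | rewrite /= fM // fx fy mulg1].
  by move=> x [Kx /= fx]; split; [exact: KV | rewrite /= fV // fx invg1].
pose coset g := [set (g * x)%g | x in N].
(* A coset is sent to the image of a chosen representative; the default 1 concerns the empty set,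
   which is no coset. *)
pose F (C : set G) := f (xget 1%g C).
have FE g : K g -> F (coset g) = f g.
  move=> Kg; rewrite /F; have : coset g (xget 1%g (coset g)).
    by apply: (xgetI 1%g (x := g)); exists 1%g; rewrite ?mulg1.
  by case=> x [Kx /= fx] <-; rewrite fM // fx mulg1.
have cosetM g h : K g -> K h -> setmulg (coset g) (coset h) = coset (g * h)%g.
  move=> Kg Kh; apply/seteqP; split=> z /=.
    move=> [_ [x [Kx /= fx] <-] [_ [y [Ky /= fy] <-] <-]].
    exists (h^-1 * x * h * y)%g; last by rewrite !mulgA mulgK.
    split; first by apply (KM _ _) => //; apply (KM _ _) => //; apply (KM _ _) => //; exact: KV.
    by rewrite /= !fM ?fV ?fx ?fy ?mulg1 ?mulVg //; do ?(apply (KM _ _) => //); exact: KV.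
  move=> [x [Kx /= fx] <-]; exists g; first by exists 1%g; rewrite ?mulg1.
  by exists (h * x)%g; rewrite ?mulgA //; exists x.
exists F; last by move=> _ _ [g Kg <-] [h Kh <-]; rewrite cosetM // !FE ?fM //; exact: KM.
split.
- by move=> _ [g Kg <-]; rewrite FE //; exact: fB.
- move=> C D /set_mem[g Kg <-] /set_mem[h Kh <-]; rewrite !FE // => gh.
  have Kgh : N (g^-1 * h)%g.
    by split; [apply (KM _ _) => //; exact: KV | rewrite /= fM ?fV ?gh ?mulVg //; exact: KV].
  apply/seteqP; split=> _ [x [Kx /= fx] <-].
    exists (h^-1 * g * x)%g; last by rewrite !mulgA mulgV mul1g.
    split; first by apply (KM _ _) => //; apply (KM _ _) => //; exact: KV.
    rewrite /= !fM ?fV ?gh ?fx ?mulVg ?mulg1 //; try (exact: KV).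
    by apply (KM _ _) => //; exact: KV.
  exists (g^-1 * h * x)%g; last by rewrite !mulgA mulgV mul1g.
  case: Kgh => k1 /= k2; split; first by apply (KM _ _).
  by rewrite /= fM // fx k2 mulg1.
by move=> y /Bf[g Kg <-]; exists (coset g); [exists g | exact: FE].
Qed.

(** * Diagonal groups *)

Definition sgn_mx (R : realType) n (s : 'I_n -> bool) : 'M[R]_n :=
  diag_mx (\row_i (-1) ^+ s i).

Lemma sgn_mxE (R : realType) n (s : 'I_n -> bool) p (v : 'M[R]_(n, p)) i j :
  (sgn_mx R s *m v) i j = (-1) ^+ s i * v i j.
Proof. by rewrite /sgn_mx mul_diag_mx !mxE. Qed.

Lemma tr_sgn_mx (R : realType) n (s : 'I_n -> bool) : (sgn_mx R s)^T = sgn_mx R s.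
Proof. by rewrite /sgn_mx tr_diag_mx. Qed.

Lemma sgn_mx_inj (R : realType) n (s s' : 'I_n -> bool) :
  sgn_mx R s = sgn_mx R s' -> s =1 s'.
Proof.
move=> /matrixP e i; have := e i i; rewrite !mxE eqxx !mulr1n => h.
by move/eqP: h; rewrite (inj_eq signr_inj) => /eqP.
Qed.

Lemma sgn_mxM (R : realType) n (s s' : 'I_n -> bool) :
  sgn_mx R s *m sgn_mx R s' = sgn_mx R (fun i => s i (+) s' i).
Proof.
by apply/matrixP => i j; rewrite sgn_mxE !mxE signr_addb mulrnAr.
Qed.

Lemma sgn_mx0 (R : realType) n (s : 'I_n -> bool) : s =1 xpred0 -> sgn_mx R s = 1%:M.
Proof. by move=> s0; apply/matrixP => i j; rewrite !mxE s0 expr0. Qed.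

Fact sgn_isom_subproof (R : realType) n (s : 'I_n -> bool) :
  (sgn_mx R s)^T *m sgn_mx R s == 1%:M.
Proof. by rewrite tr_sgn_mx sgn_mxM sgn_mx0 // => i; rewrite addbb. Qed.

Definition sgn_isom (R : realType) n (s : 'I_n -> bool) (t : 'cV[R]_n) : Isom R n :=
  @MkIsom R n (_, t) (sgn_isom_subproof R s).

(* [t] lies in the coset [Z + b/2]. *)
Definition half_int (R : realType) (b : bool) (t : R) : Prop :=
  exists z : int, t = z%:~R + b%:R / 2.

Section HalfInt.
Variable R : realType.
Implicit Types (b c s : bool) (t u : R).

Lemma half_intN b t : half_int b t -> half_int b (- t).
Proof.
move=> [z ->]; exists (- z - b%:Z); rewrite rmorphB rmorphN /=.
by case: b => /=; rewrite ?mulr0n; lra.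
Qed.

Lemma half_int_sgn s b t : half_int b t -> half_int b ((-1) ^+ s * t).
Proof. by rewrite mulr_sign; case: s => //; exact: half_intN. Qed.

Lemma half_intD b c t u : half_int b t -> half_int c u -> half_int (b (+) c) (t + u).
Proof.
move=> [z ->] [w ->]; exists (z + w + (b && c)%:Z); rewrite !rmorphD /=.
by case: b; case: c => /=; rewrite ?mulr0n; lra.
Qed.

Lemma half_int0 : half_int false (0 : R).
Proof. by exists 0; rewrite mul0r addr0. Qed.

Lemma half_intz (z : int) : half_int false (z%:~R : R).
Proof. by exists z; rewrite mul0r addr0. Qed.

Lemma half_int_double b t : half_int b t -> exists z : int, t *+ 2 = z%:~R.
Proof.
move=> [z ->]; exists (z *+ 2 + b%:Z); rewrite rmorphD rmorphMn /=.
by case: b => /=; rewrite ?mulr0n; lra.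
Qed.

Lemma half_int_true_neq0 t : half_int true t -> t != 0.
Proof.
move=> [z ->] /=; apply/eqP => e.
have : (z *+ 2 + 1)%:~R = (0 : R) by rewrite rmorphD rmorphMn rmorph1 /=; lra.
by move/eqP; rewrite intr_eq0 => /eqP; lia.
Qed.

Lemma int_close t u (z w : int) : t *+ 2 = z%:~R -> u *+ 2 = w%:~R ->
  `|t - u| < 1 / 2 -> t = u.
Proof.
move=> tz uw tu.
have : `|z - w| < 1.
  rewrite -(ltr_int R) intr_norm rmorphB /= -tz -uw -mulrnBl normrMn mulr1z.
  by move: tu; set a := `|_|; lra.
move=> zw; have zw' : z = w by lia.
by move: uw; rewrite -zw' -tz; lra.
Qed.

End HalfInt.

Section SignedHalfIntegral.
Context {R : realType} {n : nat} (Gamma : set (Isom R n)).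
Hypotheses (GG : subgroup Gamma)
  (Gsgn : forall x, Gamma x -> exists s, x.1 = sgn_mx R s)
  (Ghalf : forall x i, Gamma x -> exists z : int, x.2 i 0 *+ 2 = z%:~R)
  (Gint : forall z : 'cV[int]_n, Gamma (translation (map_mx intr z))).

(** Discreteness holds because all entries lie in (1/2)Z, cocompactness because integral
    translations bring every point into the unit cube. *)
Lemma half_integral_crystallographic : crystallographic Gamma.
Proof.
split=> //.
  move=> x Gx; apply: (@entries_isolated _ _ _ _ (1 / 2)) => // y Gy h1 h2.
  apply: isom_eq; last first.
    apply/colP => i; have [z hz] := Ghalf i Gx; have [w hw] := Ghalf i Gy.
    by symmetry; apply: (int_close hz hw).
  apply/matrixP => i j; symmetry.
  have [s es] := Gsgn Gx; have [s' es'] := Gsgn Gy.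
  have sint (t : 'I_n -> bool) : exists z : int, (sgn_mx R t) i j *+ 2 = z%:~R.
    exists ((-1) ^+ t i *+ (i == j) *+ 2).
    by rewrite !mxE !rmorphMn /= rmorphXn rmorphN1.
  have [z hz] := sint s; have [w hw] := sint s'; rewrite -es in hz; rewrite -es' in hw.
  exact: (int_close hz hw).
apply: orbit_space_compact => // x.
exists (translation (map_mx intr (\col_i - Num.floor (x i 0)))); first exact: Gint.
move=> i; rewrite /isom_act /= mul1mx !mxE rmorphN /=.
have := floor_itv (x i 0); rewrite rmorphD /= => /andP[h1 h2].
by apply/andP; split; lra.
Qed.

End SignedHalfIntegral.

Definition bool_hom (V : zmodType) (f : V -> bool) : Prop :=
  {morph f : u v / u + v >-> u (+) v}.

Section BoolHom.
Variables (V : zmodType) (f : V -> bool) (fD : bool_hom f).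

Lemma bool_hom0 : f 0 = false.
Proof. by have := fD 0 0; rewrite addr0; case: (f 0). Qed.

Lemma bool_homN v : f (- v) = f v.
Proof. by have := fD v (- v); rewrite subrr bool_hom0; case: (f v); case: (f (- v)). Qed.

End BoolHom.

Section DiagonalGroups.
Context {R : realType} {n : nat} {V : finZmodType} (chi beta : 'I_n -> V -> bool).

(* [x |-> D x + t] for [D] the diagonal matrix with signs [chi v] and [t] in
   [Z^n + beta v / 2]; up to a change of coordinates every crystallographic
   group of diagonal type has this form. *)
Definition diag_group : set (Isom R n) :=
  [set x : Isom R n | exists v, x.1 = sgn_mx R (chi ^~ v) /\
     forall i, half_int (beta i v) (x.2 i 0)].

Definition covering : Prop :=
  forall v, v != 0 -> exists i, ~~ chi i v && beta i v.

Definition faithful : Prop := forall v, v != 0 -> exists i, chi i v.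

Hypotheses (chiD : forall i, bool_hom (chi i)) (betaD : forall i, bool_hom (beta i)).

Lemma faithful_inj u v : faithful -> chi ^~ u =1 chi ^~ v -> u = v.
Proof.
move=> fth uv; apply/eqP; rewrite -subr_eq0; apply/negP => /negP /fth[i].
by rewrite chiD bool_homN // uv addbb.
Qed.

Lemma diag_group_subgroup : subgroup diag_group.
Proof.
split.
- exists 0; split; first by rewrite sgn_mx0 // => i; exact: bool_hom0.
  by move=> i; rewrite bool_hom0 // mxE; exact: half_int0.
- move=> x y [u [xu hx]] [v [yv hy]]; exists (u + v); split.
    by rewrite /= xu yv sgn_mxM; congr sgn_mx; apply/funext => i; rewrite chiD.
  move=> i; rewrite /= xu mxE sgn_mxE betaD addbC; apply: half_intD => //.
  exact: half_int_sgn.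
move=> x [u [xu hx]]; exists u; split; first by rewrite /= xu tr_sgn_mx.
by move=> i; rewrite /= xu tr_sgn_mx mxE sgn_mxE; apply: half_intN; exact: half_int_sgn.
Qed.

Lemma diag_group_translation (z : 'cV[int]_n) : diag_group (translation (map_mx intr z)).
Proof.
exists 0; split; first by rewrite sgn_mx0 // => i; exact: bool_hom0.
by move=> i; rewrite bool_hom0 // mxE; exact: half_intz.
Qed.

Lemma diag_group_crystallographic : crystallographic diag_group.
Proof.
apply: half_integral_crystallographic diag_group_translation.
- exact: diag_group_subgroup.
- by move=> x [v [xv _]]; exists (chi ^~ v).
by move=> x i [v [_ hx]]; exact: half_int_double (hx i).
Qed.

Lemma translationX (a : 'cV[R]_n) m : (translation a ^+ m)%g = translation (a *+ m).
Proof.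
elim: m => [|m IH]; first by apply: isom_eq.
by rewrite expgS IH mulrS; apply: isom_eq => /=; rewrite mul1mx // addrC.
Qed.

Lemma isom_sqr (x : Isom R n) s : x.1 = sgn_mx R s ->
  (x ^+ 2)%g = translation (\col_i if s i then 0 else x.2 i 0 *+ 2).
Proof.
move=> xs; rewrite expgS expg1; apply: isom_eq.
  by rewrite /= xs sgn_mxM sgn_mx0 // => i; rewrite addbb.
apply/colP => i; rewrite [RHS]mxE /= xs mxE sgn_mxE mulr_sign.
by case: (s i); rewrite ?addNr // mulr2n.
Qed.

(* The square of a torsion element is a translation of finite order, hence trivial,
   so the element shifts no coordinate with sign [+1]. *)
Lemma diag_group_torsion_free : covering -> torsion_free diag_group.
Proof.
move=> cov x m [v [xv hx]] m0 xm.
have : ((x ^+ 2) ^+ m = 1)%g by rewrite -expgM mulnC expgM xm expg1n.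
rewrite (isom_sqr xv) translationX => /(congr1 (fun y : Isom R n => y.2)) /= /colP e.
have e' i : ~~ chi i v -> x.2 i 0 = 0.
  move=> cv; have := e i; rewrite mulmxnE !mxE (negbTE cv) => /eqP.
  by rewrite -mulrnA mulrn_eq0 muln_eq0 (gtn_eqF m0) => /eqP.
have v0 : v = 0.
  apply/eqP; apply/negP => /negP /cov[i /andP[cv bv]].
  by have := hx i; rewrite bv e' // => /half_int_true_neq0; rewrite eqxx.
apply: isom_eq; first by rewrite xv v0 sgn_mx0 // => i; exact: bool_hom0.
by apply/colP => i; rewrite e' ?mxE // v0 bool_hom0.
Qed.

Lemma diag_group_bieberbach : covering -> bieberbach diag_group.
Proof. by split; [exact: diag_group_crystallographic | exact: diag_group_torsion_free]. Qed.

Lemma diag_group_lattice : faithful ->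
  lattice diag_group = range (fun z : 'cV[int]_n => translation (map_mx intr z)).
Proof.
move=> fth; apply/seteqP; split=> x; last first.
  by move=> [z _ <-]; split; [exact: diag_group_translation | exists (map_mx intr z)].
move=> [[v [xv hx]] [a _ ax]]; subst x.
have v0 : v = 0.
  apply/eqP; apply/negP => /negP /fth[i].
  suff -> : chi i v = false by [].
  have : sgn_mx R (chi ^~ v) = sgn_mx R xpred0 by rewrite -xv [RHS]sgn_mx0.
  by move/sgn_mx_inj; apply.
have hz i : exists z : int, a i 0 = z%:~R.
  by have := hx i; rewrite v0 bool_hom0 // => -[z ->]; exists z; rewrite mul0r addr0.
have [z az] := choice hz; exists (\col_i z i) => //.
by congr translation; apply/colP => i; rewrite !mxE az.
Qed.

(** Scalar matrices commute with sign matrices, so in the basis c the holonomy is given by the signs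
    themselves. It is applied with c = 1 for faithful characters and c = 1/2 for vanishing ones. *)
Lemma diagonal_holonomy_scalar (Gamma : set (Isom R n)) (c : R) : c != 0 ->
  lattice Gamma = range (fun z : 'cV[int]_n => translation (c *: map_mx intr z)) ->
  (forall x, Gamma x -> exists s, x.1 = sgn_mx R s) -> diagonal_holonomy Gamma.
Proof.
move=> c0 latG sgnG; exists c%:M.
  split.
  - by move=> z _; rewrite latG; exists z => //; rewrite /lattice_coord mul_scalar_mx.
  - move=> z w _ _ /(congr1 (fun y : Isom R n => y.2)) /=.
    rewrite !mul_scalar_mx => /(scalerI c0) /matrixP e; apply/matrixP => i j.
    by have := e i j; rewrite !mxE => /intr_inj.
  by move=> x; rewrite latG => -[z _ <-]; exists z => //; rewrite /lattice_coord mul_scalar_mx.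
move=> x /sgnG[s xs]; exists (diag_mx (\row_i (-1) ^+ s i)); last exact: diag_mx_is_diag.
move=> z; apply: isom_eq.
  by rewrite /= mulmx1 (mulmx1C (eqP (isom_orthogonal x))).
rewrite /= !mul_scalar_mx mulmx1 mulmxN mulmxA (mulmx1C (eqP (isom_orthogonal x))) mul1mx.
rewrite addrCA addNr addr0 xs; apply/colP => i.
rewrite sgn_mxE mul_diag_mx !mxE rmorphM /= rmorphXn rmorphN1; ring.
Qed.

Lemma diag_group_diagonal_holonomy : faithful -> diagonal_holonomy diag_group.
Proof.
move=> fth; apply: (diagonal_holonomy_scalar (oner_neq0 R)).
  rewrite diag_group_lattice //; apply: eq_imagel => z _.
  by rewrite scale1r.
by move=> x [v [xv _]]; exists (chi ^~ v).
Qed.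

(* The group is then the full translation lattice [(Z/2)^n], with [E = 1/2]. *)
Lemma diag_group_diagonal_holonomy0 : (forall i v, chi i v = false) ->
  (forall b : 'I_n -> bool, exists v, forall i, beta i v = b i) ->
  diagonal_holonomy diag_group.
Proof.
move=> chi0 beta_surj.
have half0 : (2^-1 : R) != 0 by rewrite invr_eq0 pnatr_eq0.
apply: (diagonal_holonomy_scalar half0); last first.
  by move=> x [v [xv _]]; exists (chi ^~ v).
apply/seteqP; split=> x.
  move=> [[v [_ hx]] [a _ ax]]; subst x.
  have hz i : exists z : int, a i 0 *+ 2 = z%:~R by exact: half_int_double (hx i).
  have [z az] := choice hz; exists (\col_i z i) => //.
  by congr translation; apply/colP => i; rewrite !mxE -az; lra.
move=> [z _ <-]; split; last by eexists.
have [v bv] := beta_surj (fun i => odd `|z i ord0|%N).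
exists v; split; first by rewrite [RHS]sgn_mx0.
move=> i; rewrite bv !mxE /half_int; set w := z i ord0.
exists ((w - (odd `|w|%N)%:Z) %/ 2)%Z.
have h : (w = 2 * ((w - (odd `|w|%N)%:Z) %/ 2)%Z + (odd `|w|%N)%:Z)%R by lia.
rewrite [in LHS]h rmorphD rmorphM /=; set q := ((_ %/ _)%Z).
by rewrite -!pmulrn; lra.
Qed.

Lemma diagonal_holonomy_type (Gamma : set (Isom R n)) :
  crystallographic Gamma -> diagonal_holonomy Gamma -> diagonal_type Gamma.
Proof.
move=> cG dG; exists n, Gamma; split=> //; exists id => //.
by split=> // x Gx; exists x.
Qed.

End DiagonalGroups.

Section DiagonalGroupHolonomy.
Context {R : realType} {n k : nat} (chi beta : 'I_n -> 'rV['F_2]_k -> bool).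
Hypotheses (chiD : forall i, bool_hom (chi i)) (betaD : forall i, bool_hom (beta i)).
Hypothesis fth : faithful chi.

Let Gamma : set (Isom R n) := diag_group chi beta.

(** Inverse of [v |-> sgn_mx R (chi ^~ v)], single-valued by faithfulness; 0 is the default for
    other linear parts. *)
Definition diag_class (x : Isom R n) : 'rV['F_2]_k :=
  xget 0 [set v | x.1 = sgn_mx R (chi ^~ v)].

Lemma diag_classE (x : Isom R n) v : x.1 = sgn_mx R (chi ^~ v) -> diag_class x = v.
Proof.
move=> xv; rewrite /diag_class; case: xgetP => [w _ /= xw|/(_ v)]; last by case.
by apply: (faithful_inj chiD) => //; apply: (@sgn_mx_inj R); rewrite -xw -xv.
Qed.

(** [diag_class] is a homomorphism onto F_2^k, and its kernel consists of the translations in the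
    group. *)
Lemma diag_group_holonomy : holonomy_isog Gamma [set: 'rV['F_2]_k]%G.
Proof.
have G0 : subgroup Gamma := diag_group_subgroup chiD betaD.
have [] := @kernel_isomorphic _ 'rV['F_2]_k Gamma setT diag_class G0.
- move=> x y [u [xu _]] [v [yv _]]; rewrite (diag_classE xu) (diag_classE yv).
  apply: diag_classE; rewrite /= xu yv sgn_mxM; congr sgn_mx.
  by apply/funext => i; rewrite -chiD.
- by [].
- move=> v _; exists (sgn_isom (chi ^~ v) (\col_i ((beta i v)%:R / 2))).
    exists v; split=> // i; exists 0; by rewrite mxE add0r.
  exact: diag_classE.
have -> : Gamma `&` [set x | diag_class x = 1%g] = lattice Gamma.
  apply/seteqP; split=> x [Gx].
    case: (Gx) => v [xv hx] /=; rewrite (diag_classE xv) => v0; split=> //.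
    exists x.2 => //; apply: isom_eq => //=.
    by rewrite xv v0 [RHS]sgn_mx0 // => i; exact: bool_hom0.
  move=> [a _ ax]; split=> //=; apply: diag_classE.
  by rewrite -ax [RHS]sgn_mx0 // => i; exact: bool_hom0.
move=> _ _; rewrite /holonomy_isog /=.
by have -> : [set` [set: 'rV['F_2]_k]%G] = setT by apply/seteqP; split=> x //= _; rewrite inE.
Qed.

End DiagonalGroupHolonomy.

(** Orthogonality of characters: translating the summation by w with [f w] reverses the sign of the
    sum. *)
Lemma sum_signs_hom (V : finZmodType) (f : V -> bool) : bool_hom f ->
  (exists v, f v) -> \sum_v (-1) ^+ f v = 0 :> int.
Proof.
move=> fD [w fw]; set S := LHS.
have : S = - S.
  rewrite {1}/S (reindex_inj (addrI w)) /= -sumrN; apply: eq_bigr => v _.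
  by rewrite fD fw signr_addb mulN1r.
lia.
Qed.

(** Converse of [kernel_isomorphic]: composition with the projection to cosets yields a surjective
    homomorphism with kernel N. *)
Lemma isomorphic_quotient_hom (G H : groupType) (K N : set G) (B : set H) :
  subgroup K -> subgroup N -> N `<=` K -> normal_in N K ->
  isomorphic (cosets K N) (@setmulg G) B *%g ->
  exists2 f : G -> H, (forall x y, K x -> K y -> f (x * y)%g = (f x * f y)%g) &
    [/\ forall x, K x -> B (f x), forall x, K x -> (f x = 1%g <-> N x) &
        forall y, B y -> exists2 x, K x & f x = y].
Proof.
move=> [K1 KM KV] [N1 NM NV] NK nN [F [FB Finj Fsurj] FM].
pose coset g := [set (g * x)%g | x in N].
have cK g : K g -> cosets K N (coset g) by exists g.
have cosetM g h : K g -> K h -> setmulg (coset g) (coset h) = coset (g * h)%g.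
  move=> Kg Kh; apply/seteqP; split=> z /=.
    move=> [_ [x Nx <-] [_ [y Ny <-] <-]].
    exists (h^-1 * x * h^-1^-1 * y)%g; last by rewrite !invgK !mulgA mulgK.
    by apply: (NM _ _ _ Ny); apply: nN => //; exact: KV.
  move=> [x Nx <-]; exists g; first by exists 1%g; rewrite ?mulg1.
  by exists (h * x)%g; rewrite ?mulgA //; exists x.
have fM x y : K x -> K y -> F (coset (x * y)%g) = (F (coset x) * F (coset y))%g.
  by move=> Kx Ky; rewrite -cosetM // FM //; exact: cK.
exists (F \o coset) => //; split; first by move=> x Kx; apply: FB; exact: cK.
  have F1 : F (coset 1%g) = 1%g.
    by apply: (@mulgI _ (F (coset 1%g))); rewrite -fM // !mulg1.
  move=> x Kx /=; split=> [fx|Nx].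
    have : coset x = coset 1%g by apply: Finj; rewrite ?inE ?fx ?F1 //; exact: cK.
    move=> e; have : coset x x by exists 1%g; rewrite ?mulg1.
    by rewrite e => -[y Ny]; rewrite mul1g => <-.
  rewrite -F1; congr F; apply/seteqP; split=> _ [y Ny <-].
    by exists (x * y)%g; rewrite ?mul1g //; exact: NM.
  by exists (x^-1 * y)%g; rewrite ?mulKVg ?mul1g //; apply: NM => //; exact: NV.
by move=> y /Fsurj[_ [x Kx <-] <-]; exists x.
Qed.

(** * Essential coordinates bound the dimension of quotients from below *)

Section QuotientRank.
Context {R : realType} {n k : nat} (chi beta : 'I_n -> 'rV['F_2]_k -> bool).
Hypotheses (chiD : forall i, bool_hom (chi i)) (betaD : forall i, bool_hom (beta i)).
Hypothesis fth : faithful chi.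

Let Gamma : set (Isom R n) := diag_group chi beta.

Lemma subgroup_translation_sum (N : set (Isom R n)) (I : Type) (s : seq I) (a : I -> 'cV[R]_n) :
  subgroup N -> (forall i, N (translation (a i))) -> N (translation (\sum_(i <- s) a i)).
Proof.
move=> [N1 NM NV] Na; elim: s => [|i s IH].
  by rewrite big_nil; have -> : translation 0 = 1%g :> Isom R n by apply: isom_eq.
rewrite big_cons; have -> : translation (a i + \sum_(j <- s) a j) =
    (translation (a i) * translation (\sum_(j <- s) a j))%g.
  by apply: isom_eq => /=; rewrite mul1mx // addrC.
exact: NM.
Qed.

Lemma subgroup_translationN (N : set (Isom R n)) a :
  subgroup N -> N (translation a) -> N (translation (- a)).
Proof.
move=> [_ _ NV] /NV; suff -> : (translation a)^-1%g = translation (- a) by [].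
by apply: isom_eq => /=; rewrite trmx1 ?mul1mx.
Qed.

(* Averaging against the character [chi i] isolates the [i]-th coordinate,
   because no other coordinate carries the same character. *)
Lemma normal_translation_coord (N : set (Isom R n)) (z : 'cV[int]_n) i :
  subgroup N -> normal_in N Gamma -> (forall j, j != i -> exists v, chi j v != chi i v) ->
  N (translation (map_mx intr z)) ->
  N (translation (map_mx intr (\col_j if j == i then z i 0 *+ #|'rV['F_2]_k| else 0))).
Proof.
move=> sN nN dist Nz.
(* The conjugate of z by a lift of v, times the sign of [chi i v]. Summed over v, coordinate i
   becomes 2^k times itself and all others cancel by orthogonality. *)
pose a v : 'cV[R]_n := map_mx intr (\col_j ((-1) ^+ (chi i v (+) chi j v) * z j 0)).
have Na v : N (translation (a v)).
  pose x : Isom R n := sgn_isom (chi ^~ v) (\col_i ((beta i v)%:R / 2)).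
  have Gx : Gamma x by exists v; split=> // j; exists 0; rewrite mxE add0r.
  have xz : (x * translation (map_mx intr z) * x^-1)%g =
      translation (map_mx intr (\col_j ((-1) ^+ chi j v * z j 0))).
    apply: isom_eq; first by rewrite /= mulmx1 tr_sgn_mx sgn_mxM sgn_mx0 // => j; rewrite addbb.
    rewrite /= mulmx1 tr_sgn_mx mulmxN mulmxA sgn_mxM [sgn_mx _ (fun _ => _)]sgn_mx0; last first.
      by move=> j; rewrite addbb.
    rewrite mul1mx addrCA addNr addr0; apply/colP => j.
    by rewrite sgn_mxE !mxE rmorphM /= rmorphXn rmorphN1.
  have := nN _ _ Gx Nz; rewrite xz; case: (boolP (chi i v)) => civ Nxz; last first.
    rewrite /a; suff -> : (\col_j ((-1) ^+ (chi i v (+) chi j v) * z j 0)) =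
        \col_j ((-1) ^+ chi j v * z j 0) by [].
    by apply/colP => j; rewrite !mxE (negbTE civ).
  have := subgroup_translationN sN Nxz; rewrite -map_mxN /a.
  suff -> : (\col_j ((-1) ^+ (chi i v (+) chi j v) * z j 0)) =
        - \col_j ((-1) ^+ chi j v * z j 0) by [].
  by apply/colP => j; rewrite !mxE civ signr_addb expr1 mulN1r mulNr.
have := subgroup_translation_sum (index_enum 'rV['F_2]_k) sN Na.
suff -> : \sum_v a v = map_mx intr (\col_j if j == i then z i 0 *+ #|'rV['F_2]_k| else 0) by [].
rewrite /a -map_mx_sum; congr map_mx; apply/colP => j.
rewrite summxE; under eq_bigr do rewrite mxE; rewrite -mulr_suml mxE.
have [->|ji] := eqVneq j i.
  under eq_bigr do rewrite addbb expr0; by rewrite sumr_const mulr_natl.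
rewrite (@sum_signs_hom _ (fun v => chi i v (+) chi j v)) ?mul0r //.
  move=> u v; rewrite !chiD.
  by case: (chi i u); case: (chi i v); case: (chi j u); case: (chi j v).
by have [v hv] := dist _ ji; exists v; move: hv; case: (chi i v); case: (chi j v).
Qed.

(* [g] witnesses that the [i]-th coordinate cannot be dropped: the square of a lift
   of [g] is the [i]-th basis translation. *)
Definition essential (i : 'I_n) : Prop :=
  (forall j, j != i -> exists v, chi j v != chi i v) /\
  exists g, forall j, (~~ chi j g && beta j g) = (j == i).

(** If z had a nonzero coordinate i, then N would contain a nonzero multiple w of the i-th basis
    translation, which is the square of a lift x of g. Thus x^(2|w|) lies in N, hence so does x,
    although x is no translation. *)
Lemma essential_coord_eq0 (N : set (Isom R n)) (z : 'cV[int]_n) i :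
  subgroup N -> N `<=` lattice Gamma -> normal_in N Gamma ->
  (forall x m, Gamma x -> (0 < m)%N -> N (x ^+ m)%g -> N x) ->
  essential i -> N (translation (map_mx intr z)) -> z i 0 = 0.
Proof.
move=> sN Nlat nN tf [dist [g hg]] Nz; apply/eqP; apply/negP => /negP zi.
have := normal_translation_coord sN nN dist Nz.
set w := z i 0 *+ _ => Nw.
have w0 : w != 0 by rewrite /w mulrn_eq0 negb_or -lt0n zi andbT; apply/card_gt0P; exists 0.
pose x : Isom R n := sgn_isom (chi ^~ g) (\col_i ((beta i g)%:R / 2)).
have Gx : Gamma x by exists g; split=> // j; exists 0; rewrite mxE add0r.
have x2 : (x ^+ 2)%g = translation (\col_j (j == i)%:R).
  rewrite (@isom_sqr _ _ _ (chi ^~ g)) //; congr translation; apply/colP => j.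
  rewrite !mxE -hg; case: (chi j g) => //=.
  by case: (beta j g) => /=; lra.
have Nx : N x.
  apply: (tf x (2 * `|w|)%N) => //; first by rewrite muln_gt0 absz_gt0.
  rewrite expgM x2 translationX.
  have -> : (\col_j ((j == i)%:R : R)) *+ `|w| =
      map_mx intr (\col_j (if j == i then `|w|%:Z else 0)).
    by apply/colP => j; rewrite mulmxnE !mxE; case: eqP => _; rewrite ?mul0rn // -pmulrn.
  have [wp|wn] := leP 0 w.
    by rewrite gez0_abs.
  rewrite ltz0_abs //; have := subgroup_translationN sN Nw; rewrite -map_mxN.
  suff -> : - (\col_j (if j == i then w else 0)) = \col_j (if j == i then - w else 0) by [].
  by apply/colP => j; rewrite !mxE; case: eqP; rewrite ?oppr0.
have [_ [a _ ax]] := Nlat _ Nx.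
have g0 : g = 0.
  apply: (faithful_inj chiD) => // j; rewrite bool_hom0 //.
  have : sgn_mx R (chi ^~ g) = sgn_mx R xpred0.
    by rewrite [RHS]sgn_mx0 //; have := congr1 (fun y : Isom R n => y.1) ax.
  by move/sgn_mx_inj; apply.
by have := hg i; rewrite g0 (bool_hom0 (betaD i)) andbF eqxx.
Qed.

(** The basis translations at essential coordinates generate a free abelian group that meets N
    trivially, so it embeds in the discrete group [Delta]. *)
Lemma essential_le_quotient_dim (N : set (Isom R n)) m r (e : 'I_r -> 'I_n) :
  injective e -> (forall l, essential (e l)) ->
  subgroup N -> N `<=` lattice Gamma -> normal_in N Gamma ->
  diagonal_bieberbach_quotient Gamma N m -> (r <= m)%N.
Proof.
move=> einj ess sN Nlat nN [Delta [[[sD disD _] tfD] _ iso]].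
have sG : subgroup Gamma := diag_group_subgroup chiD betaD.
have NG : N `<=` Gamma by move=> x /Nlat[].
have [f fM [fD fN _]] := isomorphic_quotient_hom sG sN NG nN iso.
have [G1 GM GV] := sG; have [N1 NM NV] := sN.
have f1 : f 1%g = 1%g by apply: (@mulgI _ (f 1%g)); rewrite -fM // !mulg1.
have GX x l : Gamma x -> Gamma (x ^+ l)%g.
  by move=> Gx; elim: l => [|l IH]; rewrite ?expg0 // expgS; exact: GM.
have fX x l : Gamma x -> f (x ^+ l)%g = (f x ^+ l)%g.
  by move=> Gx; elim: l => [|l IH]; rewrite ?expg0 // !expgS fM ?IH //; exact: GX.
(* Torsion-freeness of the quotient means that N is closed under roots in [Gamma]. *)
have tf x l : Gamma x -> (0 < l)%N -> N (x ^+ l)%g -> N x.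
  move=> Gx l0 /fN; rewrite fX // => /(_ (GX _ _ Gx)) fx.
  by apply/fN => //; exact: tfD (fD _ Gx) l0 fx.
have Gt (u : 'cV[int]_n) : Gamma (translation (map_mx intr u)).
  exact: diag_group_translation.
apply: (@discrete_rank_le R m Delta 'cV[int]_n
  (fun u => f (translation (map_mx intr u))) r (fun l => delta_mx (e l) 0)) => //.
- by move=> v; exact: fD.
- move=> u v; rewrite -fM //; congr f; apply: isom_eq => /=; first by rewrite mul1mx.
  by rewrite mul1mx map_mxD addrC.
move=> z /fN - /(_ (Gt _)) /(essential_coord_eq0 sN Nlat nN tf) h l.
have := h _ (ess l); rewrite summxE (bigD1 l) //= big1 ?addr0 => [|l' l'l].
  by rewrite mulmxzE mxE !eqxx mulrzz mul1r || rewrite -scaler_int mxE mxE !eqxx mulr1 intz.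
by rewrite -scaler_int !mxE (inj_eq einj) [l == l']eq_sym (negbTE l'l) mulr0.
Qed.

End QuotientRank.

(** The members of S are essential coordinates of the associated diagonal group, so they survive in
    every admissible quotient. An arbitrary finite index type is convenient for indexing by
    pairs. *)
Lemma vasquez_bound_essential (R : realType) k d (I : finType)
    (chi beta : I -> 'rV['F_2]_k -> bool) (S : {set I}) :
  (forall i, bool_hom (chi i)) -> (forall i, bool_hom (beta i)) ->
  (forall v, v != 0 -> exists i, chi i v) ->
  (forall v, v != 0 -> exists i, ~~ chi i v && beta i v) ->
  (forall i j, i \in S -> j != i -> exists v, chi j v != chi i v) ->
  (forall i, i \in S -> exists g, forall j, (~~ chi j g && beta j g) = (j == i)) ->
  vasquez_bound R [set: 'rV['F_2]_k]%G d -> (#|S| <= d)%N.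
Proof.
move=> chiD betaD fth cov dist priv vb.
pose chi' (i : 'I_#|I|) := chi (enum_val i); pose beta' (i : 'I_#|I|) := beta (enum_val i).
have chiD' i : bool_hom (chi' i) by exact: chiD.
have betaD' i : bool_hom (beta' i) by exact: betaD.
have fth' : faithful chi'.
  by move=> v /fth[i ci]; exists (enum_rank i); rewrite /chi' enum_rankK.
have cov' : covering chi' beta'.
  by move=> v /cov[i ci]; exists (enum_rank i); rewrite /chi' /beta' enum_rankK.
have [N [sN Nlat nN [m md quo]]] := vb _ _
  (diag_group_bieberbach (R := R) chiD' betaD' cov')
  (diagonal_holonomy_type (diag_group_crystallographic chiD' betaD')
    (diag_group_diagonal_holonomy chiD' betaD' fth'))
  (diag_group_holonomy chiD' betaD' fth').
apply: leq_trans md.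
apply: (essential_le_quotient_dim chiD' betaD' fth'
  (e := fun l : 'I_#|S| => enum_rank (enum_val l))) quo => //.
  by move=> l l' /enum_rank_inj /enum_val_inj.
move=> l; have lS := enum_valP l; split.
  move=> j jl; rewrite /chi' enum_rankK; apply: dist => //.
  by apply: contra jl => /eqP <-; rewrite enum_valK.
have [g hg] := priv _ lS; exists g => j; rewrite /chi' /beta' hg.
by rewrite -(inj_eq enum_rank_inj) enum_valK.
Qed.

(** * Systems with many private vectors *)

Section Coordinates.
Variable k : nat.
Implicit Types (v : 'rV['F_2]_k) (a b c : 'I_k).

Definition coord_bit a v : bool := v 0 a != 0.

Definition bit_row (s : 'I_k -> bool) : 'rV['F_2]_k := \row_a (s a)%:R.

Lemma coord_bitK s a : coord_bit a (bit_row s) = s a.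
Proof. by rewrite /coord_bit mxE; case: (s a). Qed.

Lemma coord_bitD a : bool_hom (coord_bit a).
Proof.
move=> u v; rewrite /coord_bit mxE.
by case: (u 0 a) (v 0 a) => [[|[|//]] ?] [[|[|//]] ?].
Qed.

Lemma coord_bit0P v : reflect (forall a, coord_bit a v = false) (v == 0).
Proof.
apply: (iffP eqP) => [-> a|v0]; first by rewrite /coord_bit mxE eqxx.
by apply/rowP => a; have /negbFE/eqP -> := v0 a; rewrite mxE.
Qed.

Lemma coord_bit_neq0 v : v != 0 -> exists a, coord_bit a v.
Proof.
move=> v0; apply/existsP; apply: contraNT v0 => /existsPn h.
by apply/coord_bit0P => a; apply/negbTE.
Qed.

Definition parity v : bool := \big[addb/false]_a coord_bit a v.

Lemma parityD : bool_hom parity.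
Proof.
by move=> u v; rewrite /parity -big_split; apply: eq_bigr => a _; exact: coord_bitD.
Qed.

Lemma parity_addb_coord v a :
  parity v (+) coord_bit a v = \big[addb/false]_(c | c != a) coord_bit c v.
Proof. by rewrite /parity (bigD1 a) //= addbC addbA addbb. Qed.

(* For a < b the set [chi = 0, beta = 1] contains e_a + e_b and no other vector of
   weight at most 2; for a = b it contains e_a only.  The indices a > b are
   filler: they restore faithfulness when [k] is odd, where all other [chi]
   vanish on (1, ..., 1). *)
Definition pair_chi (i : 'I_k * 'I_k) v : bool :=
  if (i.1 < i.2)%N then coord_bit i.1 v (+) coord_bit i.2 v
  else if i.1 == i.2 then parity v (+) coord_bit i.1 v
  else odd k && coord_bit i.1 v.

Definition pair_beta (i : 'I_k * 'I_k) v : bool := (i.1 <= i.2)%N && coord_bit i.1 v.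

Definition upper_pairs : {set 'I_k * 'I_k} := [set i : 'I_k * 'I_k | (i.1 <= i.2)%N].

Lemma card_upper_pairs : #|upper_pairs| = 'C(k.+1, 2).
Proof.
(* The pairs are counted by their second entry b, with b + 1 choices of the first. *)
rewrite -bin2_sum big_nat_recl // add0n big_mkord -sum1_card.
rewrite (eq_bigl (fun i : 'I_k * 'I_k => xpredT i.2 && (i.1 <= i.2)%N)); last first.
  by move=> i; rewrite inE.
rewrite (eq_bigr (fun i : 'I_k * 'I_k => (fun _ _ => 1%N) i.2 i.1)) //.
rewrite (reindex_onto (fun p : 'I_k * 'I_k => (p.2, p.1)) (fun p => (p.2, p.1))) /=; last by case.
under eq_bigl => p do rewrite -surjective_pairing eqxx andbT.
rewrite -(pair_big_dep xpredT (fun b a : 'I_k => (a <= b)%N) (fun _ _ => 1%N)) /=.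
apply: eq_bigr => b _; rewrite sum1_card.
have inj : injective (widen_ord (ltn_ord b)).
  by move=> x y /(congr1 val) /= xy; apply: val_inj.
transitivity #|[set: 'I_b.+1]%SET|; last by rewrite cardsT card_ord.
rewrite -(card_imset _ inj); apply: eq_card => a; rewrite [LHS]inE.
apply/idP/imsetP => [|[x _ ->]]; last exact: (ltn_ord x).
by move=> ab; exists (Ordinal (ab : (a < b.+1)%N)) => //; apply: val_inj.
Qed.

Lemma pair_chiD i : bool_hom (pair_chi i).
Proof.
move=> u v; rewrite /pair_chi !coord_bitD parityD.
case: ifP => _; last case: ifP => _; last by rewrite andb_addr.
  by rewrite addbACA.
by rewrite addbACA.
Qed.

Lemma pair_betaD i : bool_hom (pair_beta i).
Proof. by move=> u v; rewrite /pair_beta coord_bitD andb_addr. Qed.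

Definition unit_row a : 'rV['F_2]_k := bit_row (pred1 a).

Lemma parity_unit_row a : parity (unit_row a) = true.
Proof.
rewrite /parity (bigD1 a) //= coord_bitK /= eqxx big1 // => b ba.
by rewrite coord_bitK /= (negbTE ba).
Qed.

(** A linear form is determined by its values on unit vectors, so characters can be compared through
    these sets. *)
Definition chi_support i : {set 'I_k} := [set c | pair_chi i (unit_row c)].

Lemma chi_supportE i : chi_support i =
  (if (i.1 < i.2)%N then [set i.1; i.2] else if i.1 == i.2 then ~: [set i.1]
  else if odd k then [set i.1] else finset.set0)%SET.
Proof.
case: i => a b; apply/setP => c; rewrite inE /pair_chi parity_unit_row !coord_bitK /=.
have [ab|ba|/val_inj ->] := ltngtP (a : nat) b.
- rewrite !inE !(eq_sym c); have [ac|//] := eqVneq a c.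
  by rewrite -ac; have [ba|//] := eqVneq b a; move: ab; rewrite ba ltnn.
- rewrite -val_eqE (gtn_eqF ba); case: (odd k); rewrite !inE //= eq_sym //.
by rewrite eqxx !inE eq_sym; case: eqP.
Qed.

(** The supports have size 2 for a < b, k - 1 for a = b and at most 1 for fillers. The first two
    sizes agree only for k = 3; the last two could agree only for k = 2, which is even, so that the
    fillers vanish. *)
Lemma chi_support_inj i j : (1 < k)%N -> k != 3 -> i \in upper_pairs ->
  chi_support i = chi_support j -> i = j.
Proof.
move=> k1 k3; rewrite inE => ile; rewrite !chi_supportE.
have cc a : #|~: [set a]%SET| = k.-1 by rewrite cardsC1 card_ord.
have c2 (p : 'I_k * 'I_k) : (p.1 < p.2)%N -> #|[set p.1; p.2]%SET| = 2.
  by move=> lt; rewrite cards2 -val_eqE (ltn_eqF lt).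
move: ile; rewrite leq_eqVlt => /orP[/eqP/val_inj ei|il].
  rewrite ei ltnn eqxx; case: ltngtP => [jl|jl|/val_inj ej].
  - by move/(congr1 (fun A : {set _} => #|A|)); rewrite cc c2 //; move: k3; lia.
  - rewrite -val_eqE (gtn_eqF jl) => /(congr1 (fun A : {set _} => #|A|)); rewrite cc.
    case: ifP => ok; rewrite ?cards1 ?cards0; last by lia.
    move=> h; have /(congr1 odd) : k = 2%N by lia.
    by rewrite ok.
  rewrite ej eqxx => /finset.setC_inj /finset.set1_inj h.
  by rewrite [i]surjective_pairing [j]surjective_pairing ei ej h.
rewrite il; case: ltngtP => [jl|jl|/val_inj ej].
- move=> e.
  have /set2P h1 : i.1 \in [set j.1; j.2]%SET by rewrite -e !inE eqxx.
  have /set2P h2 : j.1 \in [set i.1; i.2]%SET by rewrite e !inE eqxx.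
  have /set2P h3 : i.2 \in [set j.1; j.2]%SET by rewrite -e !inE eqxx orbT.
  have e1 : i.1 = j.1.
    case: h1 => // e1; case: h2 => // e2; case: h3 => e3.
      by move: il jl; rewrite e1 e3; lia.
    by move: il; rewrite e1 e3 ltnn.
  have e2 : i.2 = j.2.
    by case: h3 => // e3; move: il; rewrite e3 e1 ltnn.
  by rewrite [i]surjective_pairing [j]surjective_pairing e1 e2.
- rewrite -val_eqE (gtn_eqF jl) => /(congr1 (fun A : {set _} => #|A|)); rewrite c2 //.
  by case: ifP; rewrite ?cards1 ?cards0.
rewrite ej eqxx => /(congr1 (fun A : {set _} => #|A|)); rewrite cc c2 //; move: k3; lia.
Qed.

Lemma pair_distinct i j : (1 < k)%N -> k != 3 -> i \in upper_pairs -> j != i ->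
  exists v, pair_chi j v != pair_chi i v.
Proof.
move=> k1 k3 iS ji; apply/existsP; apply: contraNT ji => /existsPn h.
apply/eqP/esym; apply: chi_support_inj => //; apply/setP => c.
by rewrite !inE; have := h (unit_row c); rewrite negbK => /eqP.
Qed.

Lemma pair_private i : i \in upper_pairs ->
  exists g, forall j, (~~ pair_chi j g && pair_beta j g) = (j == i).
Proof.
rewrite inE leq_eqVlt => /orP[/eqP/val_inj|]; case: i => a b /=.
  move=> <-; exists (unit_row a) => -[c d].
  rewrite /pair_chi /pair_beta parity_unit_row !coord_bitK /= xpair_eqE.
  have [cd|cd|/val_inj <-] := ltngtP (c : nat) d; rewrite ?andbF /=.
  - by case: (c == a); case: (d == a).
  - have [ca|//] := eqVneq c a; have [da|//] := eqVneq d a.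
    by move: cd; rewrite ca da ltnn.
  by rewrite eqxx; case: (c == a).
move=> ab; exists (unit_row a + unit_row b) => -[c d].
rewrite /pair_chi /pair_beta parityD !parity_unit_row !coord_bitD !coord_bitK /= xpair_eqE.
have nab : (a == b) = false by rewrite -val_eqE (ltn_eqF ab).
have [cd|cd|/val_inj <-] := ltngtP (c : nat) d; rewrite ?andbF /=.
- have ncd : (c == d) = false by rewrite -val_eqE (ltn_eqF cd).
  have [ca|ca] := eqVneq c a.
    rewrite ca nab /=; have [da|da] := eqVneq d a; last by case: (d == b).
    by move: ncd; rewrite ca da eqxx.
  have [cb|cb] := eqVneq c b; last by rewrite andbF.
  have [da|da] := eqVneq d a; first by move: cd; rewrite cb da; move: ab; lia.
  by have [db|db] := eqVneq d b; first by move: ncd; rewrite cb db eqxx.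
- have [ca|//] := eqVneq c a; have [db|//] := eqVneq d b.
  by move: cd; rewrite ca db; move: ab; lia.
rewrite eqxx /=; have [ca|ca] := eqVneq c a; first by rewrite ca nab.
by case: (c == b).
Qed.

(** A vector with two nonzero bits a < b is covered by (a, b), a unit vector by its diagonal
    pair. *)
Lemma pair_covering v : v != 0 -> exists i, ~~ pair_chi i v && pair_beta i v.
Proof.
move=> /coord_bit_neq0[a va].
have [/existsP[b /andP[ba vb]]|/existsPn h] := boolP [exists b, (b != a) && coord_bit b v].
  have [ab|ab|/val_inj e] := ltngtP (a : nat) b.
  - by exists (a, b); rewrite /pair_chi /pair_beta /= ab va vb (ltnW ab).
  - by exists (b, a); rewrite /pair_chi /pair_beta /= ab va vb (ltnW ab).
  - by move: ba; rewrite e eqxx.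
exists (a, a); rewrite /pair_chi /pair_beta /= ltnn eqxx leqnn va andbT.
rewrite -[true]va parity_addb_coord big1 // => b ba.
by have := h b; rewrite ba /= => /negbTE.
Qed.

(** Two different bits are detected by their pair. The vector (1, ..., 1) is detected by a filler
    for odd k, and for even k by a diagonal pair, since its parity is then 0. *)
Lemma pair_faithful v : (1 < k)%N -> v != 0 -> exists i, pair_chi i v.
Proof.
move=> k1 /coord_bit_neq0[a va].
have [/existsP[b /negbTE vb]|/existsPn h] := boolP [exists b, ~~ coord_bit b v].
  have [ab|ab|/val_inj e] := ltngtP (a : nat) b.
  - by exists (a, b); rewrite /pair_chi /= ab va vb.
  - by exists (b, a); rewrite /pair_chi /= ab va vb.
  - by move: vb; rewrite -e va.
have h' b : coord_bit b v by have := h b; rewrite negbK.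
have [ok|ek] := boolP (odd k).
  by exists (Ordinal k1, Ordinal (ltnW k1)); rewrite /pair_chi /= ok h'.
exists (a, a); rewrite /pair_chi /= ltnn eqxx va /parity.
under eq_bigr do rewrite h'; rewrite big_const card_ord.
have -> : iter k (addb true) false = odd k.
  by elim: k => //= m ->; case: (odd m).
by rewrite (negbTE ek).
Qed.

End Coordinates.

Lemma vasquez_bound_pairs (R : realType) k d : (1 < k)%N -> k != 3 ->
  vasquez_bound R [set: 'rV['F_2]_k]%G d -> ('C(k.+1, 2) <= d)%N.
Proof.
move=> k1 k3; rewrite -card_upper_pairs.
apply: (vasquez_bound_essential (chi := @pair_chi k) (beta := @pair_beta k)).
- exact: pair_chiD.
- exact: pair_betaD.
- by move=> v; exact: pair_faithful.
- exact: pair_covering.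
- by move=> i j; exact: pair_distinct.
exact: pair_private.
Qed.

Definition rank3_chi (i : 'I_5) (v : 'rV['F_2]_3) : bool :=
  let x := coord_bit 0 v in let y := coord_bit 1 v in let z := coord_bit 2%:R v in
  nth false [:: x; y; x (+) y; z; x (+) z] i.

Definition rank3_beta (i : 'I_5) (v : 'rV['F_2]_3) : bool :=
  let x := coord_bit 0 v in let y := coord_bit 1 v in let z := coord_bit 2%:R v in
  nth false [:: y; z; x (+) z; x (+) y; y] i.

(* For [k = 3] two of the characters of the general family coincide; this family
   was found by enumeration. *)
Lemma vasquez_bound_rank3 (R : realType) d :
  vasquez_bound R [set: 'rV['F_2]_3]%G d -> (5 <= d)%N.
Proof.
have -> : 5%N = #|[set: 'I_5]%SET| by rewrite cardsT card_ord.
pose i0 : 'I_5 := Ordinal (isT : 0 < 5)%N; pose i1 : 'I_5 := Ordinal (isT : 1 < 5)%N.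
pose i2 : 'I_5 := Ordinal (isT : 2 < 5)%N; pose i3 : 'I_5 := Ordinal (isT : 3 < 5)%N.
pose i4 : 'I_5 := Ordinal (isT : 4 < 5)%N.
pose row3 s : 'rV['F_2]_3 := bit_row (fun i => nth false s i).
have nz (v : 'rV['F_2]_3) : v != 0 -> [|| coord_bit 0 v, coord_bit 1 v | coord_bit 2%:R v].
  move=> /coord_bit_neq0[[[|[|[|//]]] h] va].
  - by rewrite (_ : 0 = Ordinal h) ?va //; apply: val_inj.
  - by rewrite (_ : 1 = Ordinal h) ?va ?orbT //; apply: val_inj.
  have -> : 2%:R = Ordinal h :> 'I_3 by apply: val_inj.
  by rewrite va !orbT.
apply: (vasquez_bound_essential (chi := rank3_chi) (beta := rank3_beta)).
- move=> [[|[|[|[|[|//]]]]] ?] u v; rewrite /rank3_chi /= !coord_bitD //; exact: addbACA.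
- move=> [[|[|[|[|[|//]]]]] ?] u v; rewrite /rank3_beta /= !coord_bitD //; exact: addbACA.
- move=> v /nz; rewrite /rank3_chi.
  by case/orP => [h|/orP[h|h]]; [exists i0 | exists i1 | exists i3].
- move=> v /nz; rewrite /rank3_chi /rank3_beta.
  case: (coord_bit 0 v) (coord_bit 1 v) (coord_bit 2%:R v) => [] [] [] // _;
  by [exists i0 | exists i1 | exists i2 | exists i3 | exists i4].
- move=> i j _ ji.
  suff /existsP : [exists s : 3.-tuple bool, rank3_chi j (row3 s) != rank3_chi i (row3 s)].
    by case=> s; exists (row3 s).
  move: ji; case: i => [[|[|[|[|[|//]]]]] ?]; case: j => [[|[|[|[|[|//]]]]] ?] // _;
  apply/existsP; rewrite /rank3_chi /row3 /=;
  by [exists [tuple true; false; false]; rewrite !coord_bitK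
     |exists [tuple false; true; false]; rewrite !coord_bitK
     |exists [tuple false; false; true]; rewrite !coord_bitK].
(* The private vectors of the five coordinates, in order. *)
pose g := [:: [:: false; true; true]; [:: true; false; true]; [:: true; true; false];
  [:: true; false; false]; [:: true; true; true]].
move=> i _; exists (row3 (nth [::] g i)) => j.
by move: i j => [[|[|[|[|[|//]]]]] ?] [[|[|[|[|[|//]]]]] ?];
   rewrite /rank3_chi /rank3_beta /= !coord_bitK.
Qed.

(** * Minimal systems *)

Section Quadratics.
Variable k : nat.
Implicit Types (f : 'rV['F_2]_k -> bool) (v : 'rV['F_2]_k).

(** Indices (a, b) with a <= b of the monomials x_a x_b. As x_a x_a = x_a over F_2, the diagonal
    ones are linear, so these span the polynomials of degree at most 2 without constant term. *)
Let monomial := {i : 'I_k * 'I_k | i \in upper_pairs k}.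

Definition quad_eval (c : {ffun monomial -> bool}) v : bool :=
  \big[addb/false]_i (c i && (coord_bit (val i).1 v && coord_bit (val i).2 v)).

Definition quadratic f : Prop := exists c, f =1 quad_eval c.

Lemma quadratic0 : quadratic xpred0.
Proof. by exists [ffun=> false] => v; rewrite /quad_eval big1 // => i _; rewrite ffunE. Qed.

Lemma quadraticD f g : quadratic f -> quadratic g -> quadratic (fun v => f v (+) g v).
Proof.
move=> [c fc] [d gd]; exists [ffun i => c i (+) d i] => v.
rewrite fc gd /quad_eval -big_split; apply: eq_bigr => i _.
by rewrite ffunE andb_addl.
Qed.

Lemma quadratic_andl b f : quadratic f -> quadratic (fun v => b && f v).
Proof. by case: b => //= _; exact: quadratic0. Qed.

Lemma quadratic_ext f g : f =1 g -> quadratic f -> quadratic g.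
Proof. by move=> fg [c fc]; exists c => v; rewrite -fg. Qed.

Lemma quadratic_sum (I : Type) (s : seq I) (P : pred I) (F : I -> 'rV['F_2]_k -> bool) :
  (forall i, quadratic (F i)) -> quadratic (fun v => \big[addb/false]_(i <- s | P i) F i v).
Proof.
move=> qF; elim: s => [|i s IH].
  by apply: quadratic_ext quadratic0 => v; rewrite big_nil.
have [Pi|Pi] := boolP (P i).
  by apply: quadratic_ext (quadraticD (qF i) IH) => v; rewrite big_cons Pi.
by apply: quadratic_ext IH => v; rewrite big_cons (negbTE Pi).
Qed.

Lemma quadratic_monomial a b : quadratic (fun v => coord_bit a v && coord_bit b v).
Proof.
wlog ab : a b / (a <= b)%N.
  move=> wl; have [/wl //|/ltnW /wl] := leqP a b.
  by apply: quadratic_ext => v; rewrite andbC.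
have abS : (a, b) \in upper_pairs k by rewrite inE.
exists [ffun i => val i == (a, b)] => v; rewrite /quad_eval.
pose m0 : monomial := exist _ (a, b) abS.
rewrite (bigD1 m0) //= ffunE eqxx /= big1 ?addbF // => i.
by rewrite ffunE -val_eqE /= => /negbTE ->.
Qed.

Lemma bool_hom_coord f v : bool_hom f ->
  f v = \big[addb/false]_a (coord_bit a v && f (unit_row a)).
Proof.
move=> fD; have -> : v = \sum_a (if coord_bit a v then unit_row a else 0).
  apply/rowP => b; rewrite summxE (bigD1 b) //= big1 => [|a ab].
    rewrite addr0 /coord_bit; case: eqP => [->|/eqP vb]; first by rewrite mxE.
    by rewrite mxE /= eqxx; move: vb; case: (v 0 b) => [[|[|//]] ?] // _; apply: val_inj.
  by case: ifP; rewrite mxE //= eq_sym (negbTE ab).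
set w := \sum_a _; have -> : f w = \big[addb/false]_a f (if coord_bit a v then unit_row a else 0).
  by rewrite /w (big_morph f fD (bool_hom0 fD)).
apply: eq_bigr => a _.
have -> : coord_bit a w = coord_bit a v.
  rewrite /w; rewrite (big_morph (coord_bit a) (coord_bitD a) (bool_hom0 (coord_bitD a))).
  rewrite (bigD1 a) //= big1 => [|b ba].
    by rewrite addbF; case: ifP => h; rewrite ?coord_bitK /= ?eqxx // (bool_hom0 (coord_bitD a)).
  by case: ifP => h; rewrite ?(bool_hom0 (coord_bitD a)) // coord_bitK /= eq_sym (negbTE ba).
by case: ifP; rewrite ?(bool_hom0 fD).
Qed.

Lemma quadratic_hom f : bool_hom f -> quadratic f.
Proof.
move=> fD; apply: (@quadratic_ext (fun v => \big[addb/false]_a (coord_bit a v && f (unit_row a)))).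
  by move=> v; rewrite -bool_hom_coord.
apply: quadratic_sum => a.
apply: (@quadratic_ext (fun v => f (unit_row a) && (coord_bit a v && coord_bit a v))).
  by move=> v; rewrite andbb andbC.
by apply: quadratic_andl; exact: quadratic_monomial.
Qed.

Lemma quadratic_homM f g : bool_hom f -> bool_hom g -> quadratic (fun v => f v && g v).
Proof.
move=> fD gD.
apply: (@quadratic_ext (fun v => \big[addb/false]_a \big[addb/false]_b
   ((f (unit_row a) && g (unit_row b)) && (coord_bit a v && coord_bit b v)))).
  move=> v; rewrite (bool_hom_coord v fD) (bool_hom_coord v gD) big_distrl /=.
  apply: eq_bigr => a _; rewrite big_distrr /=; apply: eq_bigr => b _.
  by case: (f _); case: (g _); rewrite ?andbT ?andbF //= andbC.
apply: quadratic_sum => a; apply: quadratic_sum => b.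
by apply: quadratic_andl; exact: quadratic_monomial.
Qed.

(* Independence of the functionals [ev i] enters as joint surjectivity, so that
   comparing [2 ^ #|I|] with the number of coefficient vectors suffices. *)
Lemma quadratic_dim (I : finType) (ev : I -> ('rV['F_2]_k -> bool) -> bool) :
  (forall u : {ffun I -> bool}, exists2 f, quadratic f & forall i, ev i f = u i) ->
  (forall i f g, f =1 g -> ev i f = ev i g) ->
  (#|I| <= 'C(k.+1, 2))%N.
Proof.
move=> surj ext; rewrite -card_upper_pairs.
pose e (c : {ffun monomial -> bool}) : {ffun I -> bool} := [ffun i => ev i (quad_eval c)].
have esurj u : u \in codom e.
  have [f [c fc] evf] := surj u; apply/codomP; exists c; apply/ffunP => i.
  by rewrite ffunE -evf; apply: ext.
have : (#|{ffun I -> bool}| <= #|{ffun monomial -> bool}|)%N.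
  rewrite -(size_codom e); apply: leq_trans (card_size _); apply: subset_leq_card.
  by apply/fintype.subsetP => u _; exact: esurj.
by rewrite !card_ffun card_bool leq_exp2l // card_sig.
Qed.

End Quadratics.

Lemma card_strict_pairs t : #|[set i : 'I_t * 'I_t | (i.1 < i.2)%N]%SET| = 'C(t, 2).
Proof.
have := card_upper_pairs t; rewrite binS bin1.
have -> : upper_pairs t = [set i : 'I_t * 'I_t | (i.1 < i.2)%N]%SET :|: [set (a, a) | a : 'I_t]%SET.
  apply/setP => -[a b]; rewrite !inE /= leq_eqVlt orbC; congr (_ || _).
  apply/idP/imsetP => [/eqP/val_inj ->|[c _ [-> ->]] //]; by exists b.
rewrite cardsU card_imset ?card_ord; last by move=> a b [].
set X := (_ :&: _)%SET; have -> : X = finset.set0.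
  apply/setP => -[a b]; rewrite !inE /=; apply/negP => /andP[ab /imsetP[c _ [ea eb]]].
  by move: ab; rewrite ea eb ltnn.
by rewrite cards0 subn0 => /eqP; rewrite eqn_add2r => /eqP.
Qed.

(** * Counting the coordinates of a minimal system *)

Section Irreducible.
Variables (k n : nat) (chi beta : 'I_n -> 'rV['F_2]_k -> bool).
Hypotheses (chiD : forall i, bool_hom (chi i)) (betaD : forall i, bool_hom (beta i)).

Let cov i v := ~~ chi i v && beta i v.

(** In a minimal system dropping j breaks either covering, which gives the private vector [g j], or
    faithfulness, which gives [h j], detected by j alone. *)
Variables (J : {set 'I_n}) (g h : 'I_n -> 'rV['F_2]_k).
Hypothesis gP : forall j, j \in J -> forall l, cov l (g j) = (l == j).
Hypothesis hP : forall t, t \notin J -> forall l, chi l (h t) = (l == t).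

Lemma private_g_inj : {in J &, injective g}.
Proof.
move=> i j iJ jJ e; apply/eqP; have := gP iJ i.
by rewrite e gP // eqxx.
Qed.

Lemma chi_gh j t : j \in J -> t \notin J ->
  (chi j (g j) = false) * (beta j (g j) = true) * (chi j (h t) = false).
Proof.
move=> jJ tJ; have := gP jJ j; rewrite eqxx /cov => /andP[/negbTE -> ->].
by rewrite hP //; case: eqP => // e; move: tJ; rewrite -e jJ.
Qed.

(* Second differences at [h t, h t'] kill the covering functions of J, which
   are linear on the span of the [h t], and read off the coefficient of
   [chi t * chi t']. *)
Lemma irreducible_count : (#|J| + 'C(n - #|J|, 2) <= 'C(k.+1, 2))%N.
Proof.
pose t := #|~: J|%SET.
have -> : (n - #|J|)%N = t by have := cardsC J; rewrite card_ord -/t => nJ; lia.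
pose tv (a : 'I_t) : 'I_n := enum_val a.
have tvJ a : tv a \notin J by have := enum_valP a; rewrite inE.
pose pairs := {i : 'I_t * 'I_t | i \in [set i : 'I_t * 'I_t | (i.1 < i.2)%N]%SET}.
have <- : #|{: {j | j \in J} + pairs}| = (#|J| + 'C(t, 2))%N.
  rewrite card_sum !card_sig -card_strict_pairs.
  by congr (_ + _)%N; apply: eq_card => x; rewrite inE.
pose ev (i : {j | j \in J} + pairs) (f : 'rV['F_2]_k -> bool) : bool :=
  match i with
  | inl j => f (g (val j))
  | inr p => f (h (tv (val p).1)) (+) f (h (tv (val p).2)) (+)
             f (h (tv (val p).1) + h (tv (val p).2))
  end.
apply: (quadratic_dim (ev := ev)); last first.
  by move=> [j|p] f f' ff' /=; rewrite !ff'.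
move=> u.
(* Interpolation in two stages: [f0] attains the prescribed second differences; the covering
   functions, invisible to these, then correct the values at private vectors. *)
pose f0 v := \big[addb/false]_(p : pairs)
  (u (inr p) && (chi (tv (val p).1) v && chi (tv (val p).2) v)).
pose f v := f0 v (+) \big[addb/false]_(j : {j | j \in J})
  ((u (inl j) (+) f0 (g (val j))) && cov (val j) v).
exists f.
  apply: quadraticD; apply: quadratic_sum => i; apply: quadratic_andl.
    by apply: quadratic_homM; exact: chiD.
  apply: (@quadratic_ext _ (fun v => beta (val i) v (+) (chi (val i) v && beta (val i) v))).
    by move=> v; rewrite /cov; case: (chi _ v); case: (beta _ v).
  by apply: quadraticD; [exact: quadratic_hom | exact: quadratic_homM].
move=> [j|p] /=.
  rewrite /f (bigD1 j) //= big1 => [|j' j'j]; last first.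
    by rewrite gP ?(valP j) // -val_eqE in j'j *; rewrite (negbTE j'j) andbF.
  by rewrite gP ?(valP j) // eqxx andbT addbF addbC addbK.
(* [chi j] vanishes at both vectors, so the covering function agrees with the linear [beta j] on
   their span. *)
have cov_lin j x y : j \in J -> x \notin J -> y \notin J ->
    cov j (h x) (+) cov j (h y) (+) cov j (h x + h y) = false.
  move=> jJ xJ yJ; rewrite /cov chiD betaD !(chi_gh jJ xJ) !(chi_gh jJ yJ) /=.
  by case: (beta j (h x)); case: (beta j (h y)).
pose D F := F (h (tv (val p).1)) (+) F (h (tv (val p).2)) (+)
  F (h (tv (val p).1) + h (tv (val p).2)) : bool.
have DD F G : D (fun v => F v (+) G v) = D F (+) D G.
  rewrite /D; set a := F _; set b := F _; set c := F _; set a' := G _; set b' := G _; set c' := G _.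
  by case: a; case: b; case: c; case: a'; case: b'; case: c'.
have Dand b F : D (fun v => b && F v) = b && D F by rewrite /D; case: b.
have Dsum (I : finType) (F : I -> _ -> bool) :
    D (fun v => \big[addb/false]_i F i v) = \big[addb/false]_i D (F i).
  by rewrite /D -!big_split.
rewrite -/(D f) /f DD !Dsum [X in _ (+) X]big1 ?addbF; last first.
  by move=> j _; rewrite Dand /D cov_lin ?andbF // (valP j).
rewrite (bigD1 p) //= Dand big1 ?addbF => [|q qp].
  rewrite /D !chiD !hP // !eqxx /=.
  have : tv (val p).1 != tv (val p).2.
    rewrite (inj_eq enum_val_inj) -val_eqE /= ltn_eqF //.
    by have := valP p; rewrite inE.
  by move=> /negbTE ne; rewrite ne eq_sym ne /= andbT.
rewrite Dand /D !chiD !hP // !(inj_eq enum_val_inj).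
have := valP p; have := valP q; rewrite !inE.
case: p q qp {D DD Dand Dsum} => -[a b] pS [[c d] qS] /=.
rewrite -val_eqE /= xpair_eqE => cdab cd ab.
(* The difference is 1 only if {c, d} = {a, b}, and c < d, a < b then force the pairs to be
   equal. *)
suff -> : (c == a) && (d == a) (+) ((c == b) && (d == b))
   (+) (((c == a) (+) (c == b)) && ((d == a) (+) (d == b))) = false by rewrite andbF.
have nab : (a == b) = false by rewrite -val_eqE (ltn_eqF ab).
have ncd : (c == d) = false by rewrite -val_eqE (ltn_eqF cd).
move: cdab; have [ca|ca] := eqVneq c a; have [db|db] := eqVneq d b => //= _.
- rewrite -ca eq_sym ncd /=; have [cb|//] := eqVneq c b; by rewrite -ca cb eqxx in nab.
- have [cb|cb] := eqVneq c b; first by rewrite db cb eqxx in ncd.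
  have [da|da] := eqVneq d a => //; by rewrite -db -da eqxx in nab.
have [cb|cb] := eqVneq c b => //; have [da|da] := eqVneq d a => //.
by move: cd ab; rewrite cb da; lia.
Qed.

End Irreducible.

(** With c coordinates outside J this turns [irreducible_count] into a bound on n; its 1 is the
    source of the summand [(3 < k)] below. *)
Lemma leq_bin2 c : (c <= 'C(c, 2).+1)%N.
Proof.
case: c => // c; rewrite binS bin1; case: c => // c.
by rewrite binS bin1; lia.
Qed.

Lemma leq_bin2_3 c : (2 < c)%N -> (c <= 'C(c, 2))%N.
Proof.
case: c => [|[|[|c]]] // _.
rewrite binS bin1; have := leq_bin2 c.+2; lia.
Qed.

Lemma uniq_size_le_card (T : finType) (s : seq T) (A : {set T}) :
  uniq s -> {subset s <= A} -> (size s <= #|A|)%N.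
Proof.
move=> us sA; rewrite -(card_uniqP us); apply: subset_leq_card.
exact/fintype.subsetP.
Qed.

Section RankTwoVectors.
Variable k : nat.
Implicit Types u v w : 'rV['F_2]_k.

Lemma addvv v : v + v = 0.
Proof. by apply/eqP/coord_bit0P => a; rewrite coord_bitD addbb. Qed.

Lemma addv_eq u v w : u + v = w -> u = w + v.
Proof. by move=> <-; rewrite -addrA addvv addr0. Qed.

Lemma addv_eq0 u v : u + v = 0 -> u = v.
Proof. by move/addv_eq; rewrite add0r. Qed.

Lemma card_rV2 : #|{: 'rV['F_2]_k}| = (2 ^ k)%N.
Proof. by rewrite card_mx card_Fp // mul1n. Qed.

End RankTwoVectors.

(** * Sharper bounds in ranks 2 and 3 *)

Section SmallRank.
Variables (k n : nat) (chi beta : 'I_n -> 'rV['F_2]_k -> bool).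
Hypotheses (chiD : forall i, bool_hom (chi i)) (betaD : forall i, bool_hom (beta i)).

Let cov i v := ~~ chi i v && beta i v.

Variables (J : {set 'I_n}) (g h : 'I_n -> 'rV['F_2]_k).
Hypothesis gP : forall j, j \in J -> forall l, cov l (g j) = (l == j).
Hypothesis hP : forall t, t \notin J -> forall l, chi l (h t) = (l == t).
Hypothesis mergeP : forall i j, i != j -> chi i =1 chi j ->
  exists v, [/\ cov i v, cov j v & forall l, l != i -> l != j -> ~~ cov l v].

Let g_inj : {in J &, injective g} := private_g_inj gP.

Let g_neq0 j : j \in J -> g j != 0.
Proof.
move=> jJ; apply/eqP => g0; have := gP jJ j.
by rewrite g0 eqxx /cov (bool_hom0 (betaD j)) andbF.
Qed.

Let h_neq0 t : t \notin J -> h t != 0.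
Proof.
move=> tJ; apply/eqP => h0; have := hP tJ t.
by rewrite h0 eqxx (bool_hom0 (chiD t)).
Qed.

(** The set covered by j avoids 0 and the private vectors of all other members of J. *)
Let cover_card j : j \in J -> (#|[set v | cov j v]%SET| + #|J| <= 2 ^ k)%N.
Proof.
move=> jJ; rewrite -card_rV2.
pose B : {set 'rV['F_2]_k} := (0 |: g @: (J :\ j))%SET.
have cB : #|B| = #|J|.
  rewrite cardsU1 card_in_imset; last by move=> x y /setD1P[_ xJ] /setD1P[_ yJ]; exact: g_inj.
  rewrite [in RHS](cardsD1 j) jJ; congr (_ + _)%N.
  case: imsetP => // -[x /setD1P[_ xJ] e]; by have := g_neq0 xJ; rewrite -e eqxx.
rewrite -cB -cardsUI [X in (_ + X)%N](_ : _ = 0%N) ?addn0 ?max_card //.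
apply/eqP; rewrite cards_eq0; apply/eqP/setP => v; rewrite !inE; apply/negP.
move=> /andP[cv /orP[/eqP v0|/imsetP[l /setD1P[lj lJ] e]]].
  by move: cv; rewrite v0 /cov (bool_hom0 (betaD j)) andbF.
by move: cv; rewrite e gP // => /eqP jl; rewrite jl eqxx in lj.
Qed.

(* [phi j] moves the kernel of [chi j] into the set covered by [j]. *)
Let phi j v := if beta j v then v else g j + v.

Let phi_cov j v : j \in J -> chi j v = false -> cov j (phi j v).
Proof.
move=> jJ cv; have := gP jJ j; rewrite eqxx /cov /phi => /andP[/negbTE cg bg].
by case: ifP => bv; rewrite ?cv ?bv // chiD betaD cg cv bg bv.
Qed.

Let phi_neq j v : v != 0 -> v != g j -> phi j v != g j.
Proof.
move=> v0 vg; rewrite /phi; case: ifP => // _; apply: contra v0 => /eqP e.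
by rewrite -(inj_eq (addrI (g j))) e addr0.
Qed.

Let phi_inj j u v : phi j u = phi j v -> u = v \/ g j = u + v.
Proof.
rewrite /phi; case: (beta j u) (beta j v) => [] [] e.
- by left.
- by right; rewrite e -addrA addvv addr0.
- by right; rewrite addrC; exact: addv_eq.
by left; exact: addrI e.
Qed.

(** For j with [g j] different from [h t], both [g j] and [phi j (h t)] are covered by j, so
    [cover_card] would give 2 + 3 <= 4. *)
Lemma rank2_irreducible : k = 2%N -> #|J| = 3%N -> forall t, t \notin J -> False.
Proof.
move=> k2 J3 t tJ.
have [j jJ gh] : exists2 j, j \in J & h t != g j.
  have /card_gt1P[j1 [j2 [j1J j2J j12]]] : (1 < #|J|)%N by rewrite J3.
  have [e|] := eqVneq (h t) (g j1); last by exists j1.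
  exists j2 => //; rewrite e; apply: contra j12 => /eqP e'.
  by apply/eqP; apply: (g_inj j1J j2J); rewrite -e -e'.
have := cover_card jJ; rewrite J3 [in (2 ^ _)%N]k2.
have : (2 <= #|[set v | cov j v]%SET|)%N.
  apply: (@uniq_size_le_card _ [:: g j; phi j (h t)]).
    by rewrite /= inE eq_sym phi_neq ?h_neq0.
  move=> v; rewrite !inE => /orP[] /eqP ->; first by rewrite gP.
  by apply: phi_cov => //; rewrite (chi_gh gP hP jJ tJ).
by move=> h2 /(leq_trans (leq_add h2 (leqnn 3))).
Qed.

(** Some [g j] lies outside the span of [h t] and [h t']. Then [g j] and the images under [phi j] of
    the three nonzero vectors of the span are distinct, and [cover_card] would give 4 + 5 <= 8. *)
Lemma rank3_irreducible5 : k = 3%N -> #|J| = 5%N ->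
  forall t t', t \notin J -> t' \notin J -> t != t' -> False.
Proof.
move=> k3 J5 t t' tJ t'J tt'.
have hh' : h t != h t'.
  by apply/eqP => e; have := hP tJ t; rewrite e hP // eqxx (negbTE tt').
pose H := [:: 0; h t; h t'; h t + h t'].
have [j jJ gH] : exists2 j, j \in J & g j \notin H.
  apply/exists_inP; apply: contraT; rewrite negb_exists_in => /forall_inP gH.
  have : (#|g @: J|%SET <= size H)%N.
    apply: leq_trans (card_size H); apply: subset_leq_card; apply/fintype.subsetP.
    by move=> _ /imsetP[j jJ ->]; have := gH _ jJ; rewrite negbK.
  by rewrite card_in_imset // J5.
move: gH; rewrite !inE !negb_or => /and4P[g0 gh gh' ghh'].
have ch := chi_gh gP hP jJ tJ; have ch' := chi_gh gP hP jJ t'J.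
have hh0 : h t + h t' != 0 by apply: contra hh' => /eqP/addv_eq0 ->.
have := cover_card jJ; rewrite J5 [in (2 ^ _)%N]k3.
have : (4 <= #|[set v | cov j v]%SET|)%N.
  apply: (@uniq_size_le_card _ [:: g j; phi j (h t); phi j (h t'); phi j (h t + h t')]).
    have n1 : phi j (h t) != g j by rewrite phi_neq ?h_neq0 // eq_sym.
    have n2 : phi j (h t') != g j by rewrite phi_neq ?h_neq0 // eq_sym.
    have n3 : phi j (h t + h t') != g j by rewrite phi_neq // eq_sym.
    rewrite /= !inE !negb_or ![g j == _]eq_sym n1 n2 n3 /=.
    rewrite !andbT -andbA; apply/and3P; split; apply/eqP => /phi_inj[].
    - by move/eqP; rewrite (negbTE hh').
    - by move/eqP; rewrite (negbTE ghh').
    - by move/eqP; rewrite -{1}[h t]addr0 (inj_eq (addrI _)) eq_sym (negbTE (h_neq0 t'J)).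
    - by move/eqP; rewrite addrA addvv add0r (negbTE gh').
    - by move/eqP; rewrite -{1}[h t']add0r (inj_eq (addIr _)) eq_sym (negbTE (h_neq0 tJ)).
    - by move/eqP; rewrite addrCA addvv addr0 (negbTE gh).
  move=> v; rewrite !inE => /or4P[] /eqP ->; first by rewrite gP.
  - by apply: phi_cov; rewrite ?ch.
  - by apply: phi_cov; rewrite ?ch'.
  by apply: phi_cov; rewrite // chiD ch ch'.
by move=> h4 /(leq_trans (leq_add h4 (leqnn 5))).
Qed.

(* Six private points leave a single further nonzero vector w; it is covered by
   every j in J, and two coordinates with private points g and g + w share
   their character and could be merged. *)
Lemma rank3_irreducible6 : k = 3%N -> #|J| = 6%N -> forall t, t \notin J -> False.
Proof.
move=> k3 J6 t tJ.
have [w Ww] : exists w, ~: (0 |: g @: J)%SET = [set w]%SET.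
  apply/cards1P; rewrite cardsCs finset.setCK card_rV2 cardsU1 card_in_imset // J6.
  have -> : (2 ^ k = 8%N)%N by rewrite k3.
  case: imsetP => // -[x xJ e]; by have := g_neq0 xJ; rewrite -e eqxx.
have Wg j : j \in J -> g j != w.
  move=> jJ; apply/eqP => e; have : w \in ~: (0 |: g @: J)%SET by rewrite Ww inE.
  by rewrite !inE negb_or -e imset_f // andbF.
have w0 : w != 0.
  have : w \in ~: (0 |: g @: J)%SET by rewrite Ww inE.
  by rewrite !inE negb_or => /andP[].
have gJ v : v != 0 -> v != w -> exists2 l, l \in J & v = g l.
  move=> v0 vw; apply/imsetP; apply: contraNT vw => vJ.
  have : v \in ~: (0 |: g @: J)%SET by rewrite !inE negb_or v0.
  by rewrite Ww inE.
have covJ j v : j \in J -> cov j v -> v = g j \/ v = w.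
  move=> jJ cv; have [->|vw] := eqVneq v w; [by right | left].
  have v0 : v != 0.
    by apply/eqP => v0; move: cv; rewrite v0 /cov (bool_hom0 (betaD j)) andbF.
  have [l lJ e] := gJ _ v0 vw.
  by move: cv; rewrite e gP // => /eqP ->.
have phiw j v : j \in J -> chi j v = false -> v != 0 -> v != g j -> v = w \/ v = w + g j.
  move=> jJ cv v0 vg; have [e|] := covJ _ _ jJ (phi_cov jJ cv).
    by have := phi_neq v0 vg; rewrite e eqxx.
  rewrite /phi; case: ifP => _; first by left.
  by rewrite addrC => /addv_eq; right.
(* Otherwise each of the six private vectors would be [h t] or [h t + w]. *)
have hw : h t = w.
  apply/eqP; apply: contraT => hw.
  have : (#|g @: J|%SET <= size [:: h t; h t + w]%R)%N.
    apply: leq_trans (card_size _); apply: subset_leq_card; apply/fintype.subsetP.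
    move=> _ /imsetP[j jJ ->]; rewrite !inE; have [//|gh] := eqVneq (g j) (h t).
    have hg : h t != g j by rewrite eq_sym.
    have [e|e] := phiw j (h t) jJ (chi_gh gP hP jJ tJ).2 (h_neq0 tJ) hg.
      by rewrite e eqxx in hw.
    by rewrite e addrAC addvv add0r eqxx.
  by rewrite card_in_imset // J6.
have covw j : j \in J -> cov j w.
  move=> jJ; have cw : chi j w = false by rewrite -hw (chi_gh gP hP jJ tJ).
  have := phi_cov jJ cw; rewrite {1}/phi; case: ifP => // bw cgw.
  have [e|e] := covJ _ _ jJ cgw.
    by move: w0; rewrite -(inj_eq (addrI (g j))) e addr0 eqxx.
  by have := g_neq0 jJ; rewrite -(inj_eq (addIr w)) e add0r eqxx.
have /card_gt0P[j jJ] : (0 < #|J|)%N by rewrite J6.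
have [l lJ e] : exists2 l, l \in J & g j + w = g l.
  apply: gJ; first by apply: contra (Wg _ jJ) => /eqP/addv_eq0 ->.
  by rewrite -{2}[w]add0r (inj_eq (addIr _)) g_neq0.
have lj : l != j.
  apply: contra w0 => /eqP lj; rewrite -(inj_eq (addrI (g j))) e lj addr0 //.
have kerK i v : i \in J -> chi i v = false -> v \in [:: 0; g i; w; g i + w].
  move=> iJ cv; rewrite !inE; have [//|v0] := eqVneq v 0; have [//|vg] := eqVneq v (g i).
  by have [->|->] := phiw i v iJ cv v0 vg; rewrite ?eqxx // addrC eqxx !orbT.
have Kker i v : i \in J -> v \in [:: 0; g i; w; g i + w] -> chi i v = false.
  move=> iJ; have := covw i iJ => /andP[/negbTE cw _].
  have := gP iJ i; rewrite eqxx => /andP[/negbTE cg _].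
  by rewrite !inE => /or4P[] /eqP ->; rewrite ?(bool_hom0 (chiD i)) // chiD cg cw.
(* Since [g l = g j + w], the kernels of [chi l] and [chi j] are the same plane. *)
have KK : [:: 0; g l; w; g l + w] =i [:: 0; g j; w; g j + w].
  move=> v; rewrite !inE -e -addrA addvv addr0.
  by case: (v == 0); case: (v == g j); case: (v == w); case: (v == g j + w).
have cjl : chi l =1 chi j.
  move=> v; case cl: (chi l v); case cj: (chi j v) => //.
    by have := kerK j v jJ cj; rewrite -KK => /(Kker _ _ lJ); rewrite cl.
  by have := kerK l v lJ cl; rewrite KK => /(Kker _ _ jJ); rewrite cj.
(* The vector covered by l and j only has to be w, yet w is covered by every member of J, and J has
   a third one. *)
have [x [clx cjx ox]] := mergeP lj cjl.
have xw : x = w.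
  have [xl|//] := covJ _ _ lJ clx; move: cjx; rewrite xl gP // eq_sym (negbTE lj) //.
have /card_gt0P[i] : (0 < #|J :\ l :\ j|%SET)%N.
  have := cardsD1 l J; have := cardsD1 j (J :\ l)%SET.
  by rewrite J6 lJ !inE jJ eq_sym lj /=; lia.
rewrite !inE => /and3P[ij il iJ].
by have := ox _ il ij; rewrite xw covw.
Qed.

(** For k > 3 the extra 1 of [leq_bin2] is allowed. For k <= 3 it can only occur with one or two
    coordinates outside J and equality in the count; the preceding lemmas exclude this, up to one
    case in rank 2. *)
Lemma irreducible_bound : (1 < k)%N ->
  (n <= 'C(k.+1, 2) + (3 < k))%N \/ [/\ k = 2%N, n = 4%N & #|J| = 2%N].
Proof.
move=> k1; have cnt := irreducible_count chiD betaD gP hP.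
have Jn : (#|J| <= n)%N by rewrite -[n in (_ <= n)%N]card_ord max_card.
have cC := cardsC J; rewrite card_ord in cC.
have l1 := leq_bin2 (n - #|J|).
case: (ltnP 3 k) => k4; first by left; lia.
have [c3|c3] := ltnP 2 (n - #|J|).
  by left; have := leq_bin2_3 c3; lia.
have small : (n - #|J| = 0%N \/ n - #|J| = 1%N \/ n - #|J| = 2%N)%N by lia.
have one : (n - #|J| = 1%N)%N -> exists t, t \notin J.
  move=> c1; have /card_gt0P[t] : (0 < #|~: J|%SET)%N by lia.
  by rewrite inE; exists t.
have two : (n - #|J| = 2%N)%N -> exists t t', [/\ t \notin J, t' \notin J & t != t'].
  move=> c2; have /card_gt1P[t [t' []]] : (1 < #|~: J|%SET)%N by lia.
  by rewrite !inE => tJ t'J tt'; exists t, t'.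
have [k2|k3] : k = 2%N \/ k = 3%N by lia.
  move: cnt; rewrite (_ : 'C(k.+1, 2) = 3%N) ?k2 // => cnt.
  case: small => [c|[c|c]]; rewrite c in cnt.
  - by left; rewrite /=; lia.
  - have [t tJ] := one c; left; rewrite bin_small // addn0 in cnt.
    have [J3|J3] : #|J| = 3%N \/ (#|J| < 3)%N by lia.
      by case: (rank2_irreducible k2 J3 tJ).
    by rewrite /=; lia.
  rewrite binn in cnt.
  have [J2|J2] : #|J| = 2%N \/ (#|J| < 2)%N by lia.
    by right; split=> //; lia.
  by left; rewrite /=; lia.
left; move: cnt; rewrite (_ : 'C(k.+1, 2) = 6%N) ?k3 // => cnt.
case: small => [c|[c|c]]; rewrite c in cnt; rewrite /= addn0.
- by lia.
- have [t tJ] := one c; rewrite bin_small // addn0 in cnt.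
  have [J6|J6] : #|J| = 6%N \/ (#|J| < 6)%N by lia.
    by case: (rank3_irreducible6 k3 J6 tJ).
  by lia.
have [t [t' [tJ t'J tt']]] := two c; rewrite binn in cnt.
have [J5|J5] : #|J| = 5%N \/ (#|J| < 5)%N by lia.
  by case: (rank3_irreducible5 k3 J5 tJ t'J tt').
by lia.
Qed.

End SmallRank.

(** * Reduction to minimal systems *)

Section Reduction.
Variable k : nat.
Let V := 'rV['F_2]_k.
(** Later instantiated with [realizes]: being the data of a quotient of the given group. *)
Variable P : forall n, ('I_n -> V -> bool) -> ('I_n -> V -> bool) -> Prop.

Hypothesis P_restrict : forall n r (chi beta : 'I_n -> V -> bool) (e : 'I_r -> 'I_n),
  injective e -> P chi beta -> P (fun i => chi (e i)) (fun i => beta (e i)).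
Hypothesis P_merge : forall n (chi beta : 'I_n -> V -> bool) i j,
  i != j -> chi i =1 chi j -> P chi beta ->
  P chi (fun l v => beta l v (+) ((l == i) && beta j v)).

Let good n (chi beta : 'I_n -> V -> bool) :=
  [/\ P chi beta, forall i, bool_hom (chi i) & forall i, bool_hom (beta i)].

(* Some vector is covered by [i] and [j] only, so that adding them up uncovers it. *)
Let unmergeable n (chi beta : 'I_n -> V -> bool) i j :=
  exists v, [/\ ~~ chi i v && beta i v, ~~ chi j v && beta j v &
    forall l, l != i -> l != j -> ~~ (~~ chi l v && beta l v)].

(** In the second alternative the quotient has trivial holonomy and is free abelian; it arises from
    the exceptional case of rank 2. *)
Let small_system := exists m (chi beta : 'I_m -> V -> bool),
  [/\ (m <= 'C(k.+1, 2) + (3 < k))%N, good chi beta, covering chi beta &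
    faithful chi \/ ((forall i v, chi i v = false) /\
      forall b : 'I_m -> bool, exists v, forall i, beta i v = b i)].

(** The two vectors [h t] span F_2^2 and the characters in J vanish on them, hence identically. The
    private vectors are then dual to the two shifts, so J alone covers everything. *)
Lemma exceptional_restrict n (chi beta : 'I_n -> V -> bool) (J : {set 'I_n}) g h :
  (forall i, bool_hom (chi i)) -> (forall i, bool_hom (beta i)) ->
  (forall j, j \in J -> forall l, ~~ chi l (g j) && beta l (g j) = (l == j)) ->
  (forall t, t \notin J -> forall l, chi l (h t) = (l == t)) ->
  k = 2%N -> n = 4%N -> #|J| = 2%N ->
  let e := fun i : 'I_#|J| => enum_val i in
  [/\ covering (fun i => chi (e i)) (fun i => beta (e i)),
      forall i v, chi (e i) v = false &
      forall b : 'I_#|J| -> bool, exists v, forall i, beta (e i) v = b i].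
Proof.
move=> chiD betaD gP hP k2 n4 J2 e.
have eJ i : e i \in J by exact: enum_valP.
have V4 : #|{: V}| = 4%N by rewrite card_rV2 k2.
have span (a b : V) : a != 0 -> b != 0 -> a != b -> forall v, v \in [:: 0; a; b; a + b].
  move=> a0 b0 ab v.
  have u : uniq [:: 0; a; b; a + b].
    have n1 : a != a + b by rewrite -{1}[a]addr0 (inj_eq (addrI a)) eq_sym.
    have n2 : b != a + b by rewrite -{1}[b]add0r (inj_eq (addIr b)) eq_sym.
    have n3 : a + b != 0 by apply: contra ab => /eqP/addv_eq0 ->.
    by rewrite /= !inE !negb_or ![0 == _]eq_sym a0 b0 ab n1 n2 n3.
  have := max_card [pred w | w \in v :: [:: 0; a; b; a + b]]; rewrite V4.
  apply: contraTT => vN; rewrite -ltnNge.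
  have uv : uniq (v :: [:: 0; a; b; a + b]) by rewrite cons_uniq vN.
  by rewrite (card_uniqP uv).
have chi0 i v : chi (e i) v = false.
  have /card_gt1P[t [t' [tJ t'J tt']]] : (1 < #|~: J|%SET)%N.
    by have := cardsC J; rewrite card_ord J2 => cC; lia.
  rewrite !inE in tJ t'J.
  have h0 s : s \notin J -> h s != 0.
    by move=> sJ; apply/eqP => e0; have := hP _ sJ s; rewrite e0 eqxx (bool_hom0 (chiD s)).
  have hh : h t != h t'.
    by apply/eqP => e0; have := hP _ tJ t; rewrite e0 hP // eqxx (negbTE tt').
  have ch s : s \notin J -> chi (e i) (h s) = false.
    by move=> sJ; rewrite hP //; case: eqP => // ei; move: sJ; rewrite -ei eJ.
  have := span _ _ (h0 _ tJ) (h0 _ t'J) hh v.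
  by rewrite !inE => /or4P[] /eqP ->; rewrite ?(bool_hom0 (chiD _)) // ?chiD !ch.
have bg i j : beta (e i) (g (e j)) = (i == j).
  by have := gP _ (eJ j) (e i); rewrite chi0 /= (inj_eq enum_val_inj).
split=> //.
  move=> v v0.
  have /card_gt1P[i [j [_ _ ij]]] : (1 < #|{: 'I_#|J|}|)%N by rewrite card_ord J2.
  have g0 l : g (e l) != 0.
    by apply/eqP => e0; have := bg l l; rewrite e0 eqxx (bool_hom0 (betaD _)).
  have gg : g (e i) != g (e j).
    by apply/eqP => e0; have := bg i i; rewrite e0 bg eqxx (negbTE ij).
  have := span _ _ (g0 i) (g0 j) gg v; rewrite !inE (negbTE v0) /= => /or3P[] /eqP ->.
  - by exists i; rewrite chi0 bg eqxx.
  - by exists j; rewrite chi0 bg eqxx.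
  by exists i; rewrite chi0 betaD !bg eqxx (negbTE ij).
move=> b; exists (\sum_(i | b i) g (e i)) => i.
rewrite (big_morph (beta (e i)) (betaD _) (bool_hom0 (betaD _))).
have [bi|bi] := boolP (b i).
  rewrite (bigD1 i) //= bg eqxx big1 // => j /andP[_ ji].
  by rewrite bg eq_sym (negbTE ji).
rewrite big1 // => j bj; rewrite bg; case: eqP => // ij.
by move: bi; rewrite ij bj.
Qed.

(** Induction on the number of coordinates: drop or merge while covering and faithfulness persist; a
    system where neither is possible satisfies [irreducible_bound]. *)
Lemma reduction n (chi beta : 'I_n -> V -> bool) : (1 < k)%N ->
  good chi beta -> covering chi beta -> faithful chi -> small_system.
Proof.
move=> k1; elim/ltn_ind: n => n IH in chi beta *.
move=> gd cov fth; have [Pcb chiD betaD] := gd.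
have [[r [e [rn einj cov' fth']]]|noR] := pselect (exists r (e : 'I_r -> 'I_n),
  [/\ (r < n)%N, injective e, covering (fun i => chi (e i)) (fun i => beta (e i)) &
      faithful (fun i => chi (e i))]).
  by apply: (IH r rn _ _ _ cov' fth'); split=> //; exact: P_restrict.
have minor (beta2 : 'I_n -> V -> bool) (j : 'I_n) : exists r (e : 'I_r -> 'I_n),
    [/\ (r < n)%N, injective e & forall l, l != j -> exists i, l = e i].
  case: n {IH chi beta gd cov fth Pcb chiD betaD noR} j beta2 => [[]//|n] j _.
  exists n, (lift j); split=> //; first exact: lift_inj.
  by move=> l lj; case: (unliftP j l) => [i ->|e]; [exists i | rewrite e eqxx in lj].
pose J : {set 'I_n} := [set j | [exists v, [forall l, (~~ chi l v && beta l v) == (l == j)]]]%SET.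
have exg j : exists v, j \in J -> forall l, ~~ chi l v && beta l v = (l == j).
  have [|jJ] := boolP (j \in J); last by exists 0.
  by rewrite inE => /existsP[v /forallP hv]; exists v => _ l; apply/eqP.
(* Without a private vector, dropping j keeps covering, so by minimality it destroys
   faithfulness. *)
have exh j : exists v, j \notin J -> forall l, chi l v = (l == j).
  have [|jJ] := boolP (j \in J); first by exists 0.
  have [r [e [rn einj er]]] := minor beta j.
  have ncov v : v != 0 -> exists i, ~~ chi (e i) v && beta (e i) v.
    move=> v0; apply: contrapT => nov; move: jJ; rewrite inE => /existsP[]; exists v.
    apply/forallP => l; apply/eqP; have [->|lj] := eqVneq l j.
      have [l' cl'] := cov _ v0; have [<- //|l'j] := eqVneq l' j.
      by have [i ei] := er _ l'j; case: nov; exists i; rewrite -ei.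
    by apply/negbTE/negP => cl; have [i ei] := er _ lj; case: nov; exists i; rewrite -ei.
  apply: contrapT => noh; apply: noR; exists r, e; split=> // v v0.
  apply: contrapT => nov; apply: noh; exists v => _ l.
  have [->|lj] := eqVneq l j.
    have [l' cl'] := fth _ v0; have [<- //|l'j] := eqVneq l' j.
    by have [i ei] := er _ l'j; case: nov; exists i; rewrite -ei.
  by apply/negbTE/negP => cl; have [i ei] := er _ lj; case: nov; exists i; rewrite -ei.
have [g gP] := choice exg; have [h hP] := choice exh.
(* If no vector is covered by i and j alone, adding [beta j] to [beta i] and dropping j leaves every
   nonzero vector covered. *)
have mergeP i j : i != j -> chi i =1 chi j -> unmergeable chi beta i j \/ small_system.
  move=> ij cij; have [|nomerge] := pselect (unmergeable chi beta i j); first by left.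
  right; have [r [e [rn einj er]]] := minor beta j.
  pose beta2 l v := beta l v (+) ((l == i) && beta j v).
  apply: (IH r rn (fun l => chi (e l)) (fun l => beta2 (e l))).
  - split=> //; first by apply: P_restrict => //; exact: P_merge.
    by move=> l u v; rewrite /beta2 !betaD andb_addr addbACA.
  - move=> v v0; apply: contrapT => nov.
    have nov' l : l != j -> ~~ (~~ chi l v && beta2 l v).
      by move=> lj; have [a ->] := er _ lj; apply/negP => ca; case: nov; exists a.
    have nl l : l != i -> l != j -> ~~ (~~ chi l v && beta l v).
      by move=> li lj; have := nov' _ lj; rewrite /beta2 (negbTE li) addbF.
    have := nov' _ ij; rewrite /beta2 eqxx /= => ni.
    have [l cl] := cov _ v0.
    apply: nomerge; exists v; split=> //; move: ni; rewrite -?cij.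
      have [li|li] := eqVneq l i; first by rewrite -li cl.
      have [lj|lj] := eqVneq l j; last by rewrite (negbTE (nl _ li lj)) in cl.
      move: cl; rewrite lj -cij; case: (chi i v) => //=.
      by case: (beta i v); case: (beta j v).
    have [lj|lj] := eqVneq l j; first by move: cl; rewrite lj -cij.
    have [li|li] := eqVneq l i; last by rewrite (negbTE (nl _ li lj)) in cl.
    move: cl; rewrite li; case: (chi i v) => //=.
    by case: (beta i v); case: (beta j v).
  move=> v v0; have [l cl] := fth _ v0.
  have [lj|lj] := eqVneq l j.
    by have [a ea] := er _ ij; exists a; rewrite -ea cij -lj.
  by have [a ea] := er _ lj; exists a; rewrite -ea.
have [[i [j [ij cij nov]]]|merge_fail] := pselect (exists i j,
    [/\ i != j, chi i =1 chi j & ~ unmergeable chi beta i j]).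
  by have [] := mergeP _ _ ij cij.
have mf i j : i != j -> chi i =1 chi j -> unmergeable chi beta i j.
  by move=> ij cij; apply: contrapT => nov; apply: merge_fail; exists i, j.
have [nle|[k2 n4 J2]] := irreducible_bound chiD betaD gP hP mf k1.
  by exists n, chi, beta; split=> //; left.
have [cov' chi0 surj] := exceptional_restrict chiD betaD gP hP k2 n4 J2.
exists #|J|, (fun i => chi (enum_val i)), (fun i => beta (enum_val i)); split=> //.
- by rewrite J2 k2.
- by split=> //; apply: P_restrict => //; exact: enum_val_inj.
by right.
Qed.

End Reduction.

(** * Groups of diagonal type *)

Section CocompactLattice.
Context {R : realType} {n k : nat} (Gamma : set (Isom R n)).
Hypotheses (GG : subgroup Gamma) (Gcomp : cocompact Gamma).

Lemma lattice_subgroup : subgroup (lattice Gamma).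
Proof.
have [G1 GM GV] := GG; split.
- by split=> //; exists 0 => //; apply: isom_eq.
- move=> x y [Gx [a _ ax]] [Gy [b _ bx]]; split; first exact: GM.
  by exists (a + b) => //; rewrite -ax -bx; apply: isom_eq; rewrite /= mul1mx // addrC.
move=> x [Gx [a _ ax]]; split; first exact: GV.
by exists (- a) => //; rewrite -ax; apply: isom_eq; rewrite /= trmx1 ?mul1mx.
Qed.

Lemma isom_linear1_translation (x : Isom R n) : x.1 = 1%:M -> x = translation x.2.
Proof. by move=> x1; apply: isom_eq. Qed.

Lemma lattice_linear1 (x : Isom R n) : Gamma x -> (lattice Gamma x <-> x.1 = 1%:M).
Proof.
move=> Gx; split=> [[_ [a _ <-]] //|x1].
by split=> //; exists x.2 => //; rewrite -isom_linear1_translation.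
Qed.

Lemma lattice_normal : normal_in (lattice Gamma) Gamma.
Proof.
have [G1 GM GV] := GG.
move=> g x Gg [Gx [a _ ax]].
have Gy : Gamma (g * x * g^-1)%g by apply: (GM); [apply: (GM) | apply: (GV)].
apply/(lattice_linear1 Gy) => /=.
by rewrite -ax /= mulmx1 (mulmx1C (eqP (isom_orthogonal g))).
Qed.

Lemma continuous_sum (T : topologicalType) (I : Type) (s : seq I) (f : I -> T -> R) :
  (forall i, continuous (f i)) -> continuous (fun x => \sum_(i <- s) f i x).
Proof.
move=> cf; elim: s => [|i s IH].
  have -> : (fun x => \sum_(i <- [::]) f i x) = fun=> 0 by apply/funext => x; rewrite big_nil.
  by move=> x; exact: cvg_cst.
have -> : (fun x => \sum_(j <- i :: s) f j x) = (fun x => f i x + \sum_(j <- s) f j x).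
  by apply/funext => x; rewrite big_cons.
by move=> x; apply: cvgD; [exact: cf | exact: IH].
Qed.

Lemma continuous_affine (T : topologicalType) (a b : R) (f : T -> R) :
  continuous f -> continuous (fun x => a * f x + b).
Proof.
move=> cf x; apply: cvgD; last exact: cvg_cst.
by apply: cvgM; [exact: cvg_cst | exact: cf].
Qed.

Lemma continuous_sqr (T : topologicalType) (f : T -> R) :
  continuous f -> continuous (fun x => f x ^+ 2).
Proof.
move=> cf; have -> : (fun x => f x ^+ 2) = f \* f by apply/funext => x; rewrite expr2.
by move=> x; apply: cvgM; exact: cf.
Qed.

Variable cl : Isom R n -> 'rV['F_2]_k.
Hypotheses (clM : forall x y, Gamma x -> Gamma y -> cl (x * y)%g = (cl x + cl y))
  (cl_lat : forall x, Gamma x -> (cl x = 0 <-> lattice Gamma x))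
  (cl_surj : forall v, exists2 x, Gamma x & cl x = v).

(* A linear form [l] vanishing on the lattice takes finitely many values on each
   orbit, and the sum of their squares descends to an unbounded continuous
   function on the compact orbit space. *)
Lemma lattice_spans (B : 'M[R]_n) :
  (forall a, lattice Gamma (translation a) -> B *m a = 0) -> B = 0.
Proof.
move=> Ba; apply/eqP; apply: contraT => B0.
have [i [j bij]] : exists i j, B i j != 0.
  apply: contrapT => nb; move: B0; rewrite (_ : B = 0) ?eqxx //.
  apply/matrixP => i j; rewrite mxE; apply: contrapT => /eqP bij.
  by apply: nb; exists i, j.
have [G1 GM GV] := GG.
have ex_rep v : exists x, Gamma x /\ cl x = v.
  by have [x Gx cx] := cl_surj v; exists x.
have [rep repP] := choice ex_rep.
pose l (y : 'cV[R]_n) := (B *m y) i 0.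
have l_lat x y : lattice Gamma x -> l (isom_act x y) = l y.
  move=> xl; have [_ [a _ ax]] := xl; rewrite -ax in xl *.
  by rewrite /l /isom_act /= mul1mx mulmxDr (Ba _ xl) addr0.
have actM g h y : isom_act g (isom_act h y) = isom_act (g * h)%g y.
  by rewrite /isom_act /= mulmxDr mulmxA addrA.
pose H (y : 'cV[R]_n) := \sum_v l (isom_act (rep v) y) ^+ 2.
have cH : continuous H.
  apply: continuous_sum => v; apply: continuous_sqr.
  have -> : (fun y => l (isom_act (rep v) y)) = (fun y =>
      1 * \sum_(m <- index_enum 'I_n) ((B *m (rep v).1) i m * y m 0 + 0) + (B *m (rep v).2) i 0).
    apply/funext => y; rewrite /l /isom_act mulmxDr mulmxA mxE [X in X + _]mxE mul1r.
    by congr (_ + _); apply: eq_bigr => m _; rewrite addr0.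
  apply: continuous_affine; apply: continuous_sum => m.
  by apply: continuous_affine; exact: coord_continuous.
(* Right multiplication by g permutes the cosets of the lattice, on each of which [l] has one value;
   in terms of [cl] it shifts the index by [cl g]. *)
have invH g y : Gamma g -> H (isom_act g y) = H y.
  move=> Gg; rewrite /H [RHS](reindex_inj (addIr (cl g))) /=; apply: eq_bigr => v _.
  congr (_ ^+ 2); rewrite actM.
  have [Gv cv] := repP v; have [Gw cw] := repP (v + cl g).
  have lat : lattice Gamma (rep v * g * (rep (v + cl g))^-1)%g.
    have Gz : Gamma (rep v * g * (rep (v + cl g))^-1)%g.
      by apply: (GM); [apply: (GM) | apply: (GV)].
    have cl1 : cl (rep v * g)%g = cl (rep (v + cl g)) by rewrite clM // cv cw.
    apply/(cl_lat Gz); rewrite clM //; [| by apply: (GM) | by apply: (GV)].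
    rewrite cl1 -clM ?mulgV //; last exact: GV.
    by have := clM G1 G1; rewrite mulg1 => /eqP; rewrite -subr_eq0 opprD addNKr oppr_eq0 => /eqP.
  by rewrite -[in LHS](mulgKV (rep (v + cl g)) (rep v * g)%g) -actM l_lat.
have [M HM] := cocompact_bounded GG Gcomp cH invH.
have b0 : B i j ^+ 2 > 0 by rewrite exprn_even_gt0.
(* Chosen so that [l] is |M| + 1 at c times the j-th unit vector; the square, already the summand at
   v = 0, exceeds M. *)
pose c := (`|M| + 1) / B i j.
have : H (c *: delta_mx j 0) <= M by apply: le_trans (HM _); exact: ler_norm.
apply: contraLR => _; rewrite -ltNge.
have [G0 c0] := repP 0.
apply: (@lt_le_trans _ _ ((`|M| + 1) ^+ 2)).
  apply: le_lt_trans (ler_norm M) _; have := normr_ge0 M; set m := `|M| => m0; nra.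
rewrite /H (bigD1 0) //= l_lat; last exact/(cl_lat G0).
have -> : l (c *: delta_mx j 0) = `|M| + 1.
  rewrite /l -scalemxAr mxE -colE mxE /c mulfVK //.
by rewrite lerDl; apply: sumr_ge0 => v _; exact: sqr_ge0.
Qed.

End CocompactLattice.

Lemma half_int_inj (R : realType) b c (t : R) : half_int b t -> half_int c t -> b = c.
Proof.
move=> hb hc; have := half_intD hb (half_intN hc); rewrite subrr.
by case: b {hb}; case: c {hc} => //= /half_int_true_neq0; rewrite eqxx.
Qed.

(** * Normal form of a torsion-free group of diagonal type *)

Section Normalization.
Context {R : realType} {n m k : nat}.
Variables (Gamma : set (Isom R n)) (Delta : set (Isom R m)) (E : 'M[R]_m).
Hypotheses (GG : subgroup Gamma) (Gcomp : cocompact Gamma) (Gtf : torsion_free Gamma).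
Hypotheses (DD : subgroup Delta) (Ddis : discrete Delta) (basE : lattice_basis Delta E).
Hypothesis (holE : forall g, Delta g -> exists2 M, holonomy_mx E g M & is_diag_mx M).
Variable phi : Isom R n -> Isom R m.
Hypotheses (phi_bij : set_bij Gamma Delta phi)
  (phiM : forall x y, Gamma x -> Gamma y -> phi (x * y)%g = (phi x * phi y)%g).
Variable cl : Isom R n -> 'rV['F_2]_k.
Hypotheses (clM : forall x y, Gamma x -> Gamma y -> cl (x * y)%g = (cl x + cl y))
  (cl_lat : forall x, Gamma x -> (cl x = 0 <-> lattice Gamma x))
  (cl_surj : forall v, exists2 x, Gamma x & cl x = v).

Let G1 : Gamma 1%g. Proof. by case: GG. Qed.
Let GM x y : Gamma x -> Gamma y -> Gamma (x * y)%g. Proof. by case: GG => _ + _; apply. Qed.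
Let GV x : Gamma x -> Gamma x^-1%g. Proof. by case: GG => _ _; apply. Qed.
Let uE : E \in unitmx := lattice_basis_unit DD Ddis basE.

Let phiG x : Gamma x -> Delta (phi x).
Proof. by case: phi_bij => + _ _ => h Gx; exact: h. Qed.

Let phi_inj x y : Gamma x -> Gamma y -> phi x = phi y -> x = y.
Proof. by case: phi_bij => _ h _ Gx Gy; apply: h; rewrite inE. Qed.

Let phi_surj y : Delta y -> exists2 x, Gamma x & phi x = y.
Proof. by case: phi_bij => _ _ h Dy; have [x Gx xy] := h _ Dy; exists x. Qed.

Let phi1 : phi 1%g = 1%g.
Proof. by apply: (@mulgI _ (phi 1%g)); rewrite -phiM // !mulg1. Qed.

Let cl1 : cl 1%g = 0.
Proof.
by have := clM G1 G1; rewrite mulg1 => /eqP; rewrite -subr_eq0 opprD addNKr oppr_eq0 => /eqP.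
Qed.

Let sqr_lattice x : Gamma x -> lattice Gamma (x * x)%g.
Proof. by move=> Gx; apply/cl_lat; [exact: GM | rewrite clM // addvv]. Qed.

Let coordD z : Delta (lattice_coord E z).
Proof. by case: basE => h _ _; have [] := h z I. Qed.

Lemma fixes_lattice_linear1 (A : 'M[R]_m) :
  (forall z : 'cV[int]_m, A *m (E *m map_mx intr z) = E *m map_mx intr z) -> A = 1%:M.
Proof.
move=> Az; suff : A *m E = E by move=> e; rewrite -[A]mulmx1 -(mulmxV uE) mulmxA e.
apply/matrixP => i j; have := Az (delta_mx j 0).
rewrite map_delta_mx mulmxA -!colE => /matrixP /(_ i 0).
by rewrite [LHS]mxE [RHS]mxE.
Qed.

(* [t] commutes with the squares of the elements mapped to lattice translations. *)
Lemma lattice_image (t : Isom R n) : lattice Gamma t -> (phi t).1 = 1%:M.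
Proof.
move=> tl; have [Gt [a _ at_]] := tl; apply: fixes_lattice_linear1 => z.
have [x Gx px] := phi_surj (coordD z).
have [_ [b _ bx]] := sqr_lattice Gx.
have comm : (t * (x * x) = (x * x) * t)%g.
  by rewrite -at_ -bx; apply: isom_eq; rewrite /= !mul1mx // addrC.
have := congr1 phi comm; rewrite (phiM Gt (GM Gx Gx)) (phiM (GM Gx Gx) Gt) (phiM Gx Gx) px.
move=> /(congr1 (fun y : Isom R m => y.2)) /=.
rewrite !mul1mx [RHS]addrC => /addIr.
set w := E *m _; rewrite mulmxDr -!mulr2n => /eqP.
rewrite -subr_eq0 -mulrnBl => /eqP/matrixP e; apply/matrixP => i j.
by have := e i j; rewrite mulmxnE !mxE => /eqP; rewrite mulrn_eq0 /= subr_eq0 => /eqP.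
Qed.

(** As [phi] is injective and sends the lattice to translations, x commutes with the lattice. Its
    linear part thus fixes the lattice, which spans by [lattice_spans]. *)
Lemma lattice_preimage (x : Isom R n) : Gamma x -> (phi x).1 = 1%:M -> lattice Gamma x.
Proof.
move=> Gx px; apply/(lattice_linear1 Gx).
apply/eqP; rewrite -subr_eq0; apply/eqP.
apply: (lattice_spans GG Gcomp clM cl_lat cl_surj) => a al.
have Ga : Gamma (translation a) by case: al.
have pa := lattice_image al.
have comm : (x * translation a = translation a * x)%g.
  apply: phi_inj; [exact: GM | exact: GM | rewrite !phiM //].
  by apply: isom_eq; rewrite /= px pa !mul1mx // addrC.
move: comm => /(congr1 (fun y : Isom R n => y.2)) /=.
by rewrite mul1mx [RHS]addrC => /addIr e; rewrite mulmxBl mul1mx e subrr.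
Qed.

Definition basis_sign (x : Isom R n) (i : 'I_m) : bool :=
  (invmx E *m (phi x).1 *m E) i i < 0.

(** The matrix is diagonal by [holE], and its square is 1 because x * x lies in the lattice. *)
Lemma basis_signE x : Gamma x -> invmx E *m (phi x).1 *m E = sgn_mx R (basis_sign x).
Proof.
move=> Gx; have [M hM dM] := holE (phiG Gx).
have AE : (phi x).1 *m E = E *m map_mx intr M.
  apply/matrixP => i j; have := hM (delta_mx j 0).
  move=> /(congr1 (fun y : Isom R m => y.2)); rewrite /lattice_coord /=.
  rewrite mulmx1 mulmxN (mulmxA (phi x).1 (phi x).1^T).
  rewrite (mulmx1C (eqP (isom_orthogonal (phi x)))) mul1mx addrCA addNr addr0.
  rewrite map_mxM /= map_delta_mx !mulmxA -!colE => /matrixP /(_ i 0).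
  by rewrite [LHS]mxE [RHS]mxE.
have BM : invmx E *m (phi x).1 *m E = map_mx intr M.
  by rewrite -mulmxA AE mulmxA mulVmx // mul1mx.
have MM : map_mx intr M *m map_mx intr M = 1%:M :> 'M[R]_m.
  have := lattice_image (sqr_lattice Gx); rewrite phiM //= => AA.
  rewrite -BM -!mulmxA (mulmxA E) mulmxV // mul1mx (mulmxA (phi x).1) AA mul1mx.
  exact: mulVmx.
have dMR i j : i != j -> (map_mx intr M : 'M[R]_m) i j = 0.
  by move=> ij; rewrite mxE (is_diag_mxP dM) ?rmorph0.
apply/matrixP => i j; rewrite BM [RHS]mxE.
have [->|ij] := eqVneq i j; last by rewrite mulr0n dMR.
have := congr1 (fun M : 'M[R]_m => M j j) MM; rewrite mxE (bigD1 j) //= big1 => [|l lj]; last first.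
  by rewrite dMR ?mul0r // eq_sym.
rewrite addr0 mulr1n [RHS]mxE eqxx -expr2 => /eqP; rewrite sqrf_eq1.
rewrite mxE /basis_sign BM !mxE.
by case/orP => /eqP ->; rewrite ?ltr10 ?ltrN10 ?expr0 ?expr1.
Qed.

Definition basis_shift (x : Isom R n) : 'cV[R]_m := invmx E *m (phi x).2.

Lemma basis_signM x y i : Gamma x -> Gamma y ->
  basis_sign (x * y)%g i = basis_sign x i (+) basis_sign y i.
Proof.
move=> Gx Gy; apply: (@sgn_mx_inj R _ _ (fun i => basis_sign x i (+) basis_sign y i)).
rewrite -sgn_mxM -(basis_signE Gx) -(basis_signE Gy) -(basis_signE (GM Gx Gy)) phiM //=.
by rewrite -!mulmxA (mulmxA E) mulmxV // mul1mx.
Qed.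

Lemma basis_shiftM x y : Gamma x -> Gamma y ->
  basis_shift (x * y)%g = sgn_mx R (basis_sign x) *m basis_shift y + basis_shift x.
Proof.
move=> Gx Gy; rewrite /basis_shift phiM //= mulmxDr -basis_signE // -!mulmxA.
by rewrite (mulmxA E) mulmxV // mul1mx.
Qed.

Lemma basis_sign_lattice x i : lattice Gamma x -> basis_sign x i = false.
Proof.
by move=> xl; rewrite /basis_sign lattice_image // mulmx1 mulVmx // mxE eqxx ltr10.
Qed.

Lemma basis_sign_faithful x : Gamma x -> (forall i, basis_sign x i = false) -> cl x = 0.
Proof.
move=> Gx x0; apply/(cl_lat Gx); apply: lattice_preimage => //.
have := basis_signE Gx; rewrite (sgn_mx0 R x0) => e.
have : E *m (invmx E *m (phi x).1 *m E) *m invmx E = 1%:M by rewrite e mulmx1 mulmxV.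
by rewrite !mulmxA mulmxV // mul1mx -mulmxA mulmxV // mulmx1.
Qed.

Lemma basis_shift_lattice x : lattice Gamma x ->
  exists z : 'cV[int]_m, basis_shift x = map_mx intr z.
Proof.
move=> xl; have x1 := lattice_image xl; have [Gx _] := xl.
have : lattice Delta (phi x).
  by split; [exact: phiG | exists (phi x).2 => //; rewrite -isom_linear1_translation].
case: basE => _ _ h /h[z _ zx]; exists z.
by rewrite /basis_shift -zx /= mulmxA mulVmx // mul1mx.
Qed.

Lemma basis_shift_surj (z : 'cV[int]_m) :
  exists2 x, lattice Gamma x & basis_shift x = map_mx intr z.
Proof.
have [x Gx px] := phi_surj (coordD z); exists x.
  by apply: lattice_preimage; rewrite // px.
by rewrite /basis_shift px /= mulmxA mulVmx // mul1mx.
Qed.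

Lemma basis_shift_inj x : lattice Gamma x -> basis_shift x = 0 -> x = 1%g.
Proof.
move=> xl s0; have [Gx _] := xl; apply: phi_inj => //; rewrite phi1.
apply: isom_eq => /=; first exact: lattice_image.
by rewrite -[LHS]mul1mx -(mulmxV uE) -mulmxA -/(basis_shift x) s0 mulmx0.
Qed.

Lemma basis_shift_double x i : Gamma x -> basis_sign x i = false ->
  exists z : int, basis_shift x i 0 *+ 2 = z%:~R.
Proof.
move=> Gx xi; have [z ez] := basis_shift_lattice (sqr_lattice Gx).
exists (z i 0); move: ez; rewrite basis_shiftM // => /matrixP /(_ i 0).
by rewrite mxE sgn_mxE xi mul1r !mxE -mulr2n.
Qed.

(* In each coordinate the origin is put at the fixed point of some reflection,
   if there is one; then all shifts become half-integers. *)
Lemma center_ex i : exists c : R, forall x, Gamma x ->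
  exists z : int, (basis_shift x i 0 - (if basis_sign x i then c else 0)) *+ 2 = z%:~R.
Proof.
have [[x0 [G0 s0]]|none] := pselect (exists x0, Gamma x0 /\ basis_sign x0 i).
  (* In this coordinate x0 is a reflection fixing c / 2. Moving the origin there changes the shift
     of every reflection by c and no other shift. *)
  exists (basis_shift x0 i 0) => x Gx; case: ifP => sx; last first.
    by rewrite subr0; exact: basis_shift_double.
  have [z] : exists z : int, basis_shift (x0 * x)%g i 0 *+ 2 = z%:~R.
    by apply: basis_shift_double; [exact: GM | rewrite basis_signM // s0 sx].
  rewrite basis_shiftM // mxE sgn_mxE s0 expr1 mulN1r => ez.
  by exists (- z); rewrite rmorphN /= -ez; lra.
exists 0 => x Gx; case: ifP => sx; first by case: none; exists x.
by rewrite subr0; exact: basis_shift_double.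
Qed.

(* [tau] is the translation part of a homomorphism from Gamma onto the diagonal
   group with data [chi], [beta], over the class map to [F_2^k]. *)
Definition realizes r (chi beta : 'I_r -> 'rV['F_2]_k -> bool) : Prop :=
  exists tau : Isom R n -> 'cV[R]_r,
  [/\ forall x y, Gamma x -> Gamma y ->
        tau (x * y)%g = sgn_mx R (chi ^~ (cl x)) *m tau y + tau x,
      forall x i, Gamma x -> half_int (beta i (cl x)) (tau x i 0) &
      forall v (t : 'cV[R]_r), (forall i, half_int (beta i v) (t i 0)) ->
        exists x, [/\ Gamma x, cl x = v & tau x = t]].

Lemma realizes_restrict r s (chi beta : 'I_r -> 'rV['F_2]_k -> bool) (e : 'I_s -> 'I_r) :
  injective e -> realizes chi beta ->
  realizes (fun i => chi (e i)) (fun i => beta (e i)).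
Proof.
move=> einj [tau [tM th ts]]; exists (fun x => \col_i tau x (e i) 0); split.
- move=> x y Gx Gy; apply/colP => i.
  rewrite [LHS]mxE tM // [LHS]mxE [RHS]mxE !sgn_mxE.
  by rewrite [X in _ = _ * X + _]mxE [X in _ = _ + X]mxE.
- by move=> x i Gx; rewrite mxE; exact: th.
move=> v t ht.
(* Dropped coordinates receive beta/2, an admissible shift. *)
pose t' : 'cV[R]_r := \col_j if [pick i | e i == j] is Some i then t i 0 else (beta j v)%:R / 2.
have ht' j : half_int (beta j v) (t' j 0).
  rewrite mxE; case: pickP => [i /eqP <-|_]; first exact: ht.
  by exists 0; rewrite add0r.
have [x [Gx cx tx]] := ts v t' ht'; exists x; split=> //.
apply/colP => i; rewrite mxE tx mxE; case: pickP => [i' /eqP/einj -> //|/(_ i)].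
by rewrite eqxx.
Qed.

Lemma realizes_merge r (chi beta : 'I_r -> 'rV['F_2]_k -> bool) i j :
  i != j -> chi i =1 chi j -> realizes chi beta ->
  realizes chi (fun l v => beta l v (+) ((l == i) && beta j v)).
Proof.
move=> ij cij [tau [tM th ts]].
exists (fun x => \col_l (tau x l 0 + (if l == i then tau x j 0 else 0))); split.
- move=> x y Gx Gy; apply/colP => l; rewrite [LHS]mxE tM // [RHS]mxE !sgn_mxE.
  rewrite [(_ + tau x) l 0]mxE [(_ + tau x) j 0]mxE !sgn_mxE.
  rewrite [X in _ = _ * X + _]mxE [X in _ = _ + X]mxE.
  have [->|_] := eqVneq l i; last by rewrite !addr0.
  by rewrite cij; ring.
- move=> x l Gx; rewrite mxE; apply: half_intD; first exact: th.
  by case: eqP => _ /=; [exact: th | exact: half_int0].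
move=> v t ht.
pose t' : 'cV[R]_r := \col_l (t l 0 - (if l == i then t j 0 else 0)).
have htj : half_int (beta j v) (t j 0).
  by have := ht j; rewrite eq_sym (negbTE ij) addbF.
have ht' l : half_int (beta l v) (t' l 0).
  rewrite mxE; have := ht l; have [->|_] := eqVneq l i => /= h; last first.
    by rewrite subr0; rewrite addbF in h.
  by have := half_intD h (half_intN htj); rewrite addbK.
have [x [Gx cx tx]] := ts v t' ht'; exists x; split=> //.
apply/colP => l; rewrite mxE tx !mxE eq_sym; have [<-|_] := eqVneq i l.
  by rewrite eq_sym (negbTE ij) subr0 subrK.
by rewrite subr0 addr0.
Qed.

(** Signs and the parities of the doubled recentered shifts are homomorphisms trivial on the
    lattice, so they descend along [cl] to [chi] and [beta]. *)
Lemma normal_form : exists chi beta : 'I_m -> 'rV['F_2]_k -> bool,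
  [/\ realizes chi beta, forall i, bool_hom (chi i), forall i, bool_hom (beta i),
      covering chi beta & faithful chi].
Proof.
have [c hc] := choice center_ex.
pose tau x : 'cV[R]_m := \col_i (basis_shift x i 0 - (if basis_sign x i then c i else 0)).
have tM x y : Gamma x -> Gamma y -> tau (x * y)%g = sgn_mx R (basis_sign x) *m tau y + tau x.
  move=> Gx Gy; apply/colP => i; rewrite [LHS]mxE basis_shiftM // basis_signM // [RHS]mxE sgn_mxE.
  rewrite [(_ + basis_shift x) i 0]mxE sgn_mxE [X in _ = _ * X + _]mxE [X in _ = _ + X]mxE.
  by case: (basis_sign x i); case: (basis_sign y i); rewrite /= ?expr0 ?expr1; ring.
(* The parity of the doubled shift; outside [Gamma] the value is arbitrary, here true. *)
have exb (x : Isom R n) i : exists b, Gamma x -> half_int b (tau x i 0).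
  have [Gx|] := pselect (Gamma x); last by exists true.
  have [z ez] := hc i _ Gx; exists (odd `|z|%N) => _.
  rewrite mxE; exists ((z - (odd `|z|%N)%:Z) %/ 2)%Z.
  have h : (z = 2 * ((z - (odd `|z|%N)%:Z) %/ 2)%Z + (odd `|z|%N)%:Z)%R by lia.
  move: ez; rewrite {1}h rmorphD rmorphM /=; set q := ((_ %/ _)%Z).
  by rewrite -!pmulrn; set u := _ - _; lra.
have exb' x : exists b : 'I_m -> bool, forall i, Gamma x -> half_int (b i) (tau x i 0).
  by have [f hf] := choice (exb x); exists f.
have [b hb'] := choice exb'.
have hb x i : Gamma x -> half_int (b x i) (tau x i 0) by exact: hb'.
have bM x y i : Gamma x -> Gamma y -> b (x * y)%g i = b x i (+) b y i.
  move=> Gx Gy; apply: half_int_inj (hb _ i (GM Gx Gy)) _.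
  rewrite tM // mxE sgn_mxE addbC; apply: half_intD; last exact: hb.
  by apply: half_int_sgn; exact: hb.
have tau_lat x : lattice Gamma x -> tau x = basis_shift x.
  by move=> xl; apply/colP => i; rewrite mxE basis_sign_lattice // subr0.
have b_lat x i : lattice Gamma x -> b x i = false.
  move=> xl; have [Gx _] := xl; apply: half_int_inj (hb x i Gx) _.
  by have [z ez] := basis_shift_lattice xl; rewrite tau_lat // ez mxE; exact: half_intz.
have ex_rep v : exists x, Gamma x /\ cl x = v by have [x Gx cx] := cl_surj v; exists x.
have [rep repP] := choice ex_rep.
have factor (f : Isom R n -> bool) :
    (forall x y, Gamma x -> Gamma y -> f (x * y)%g = f x (+) f y) ->
    (forall x, lattice Gamma x -> f x = false) ->
    (forall x, Gamma x -> f x = f (rep (cl x))) /\ bool_hom (fun v => f (rep v)).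
  move=> fM fl.
  have fe x y : Gamma x -> Gamma y -> cl x = cl y -> f x = f y.
    move=> Gx Gy xy; have Gz : Gamma (x * y^-1)%g by apply: GM => //; exact: GV.
    have : f (x * y^-1)%g = false.
      apply/fl/(cl_lat Gz); rewrite clM ?xy -?clM ?mulgV //; exact: GV.
    have : f (x * y^-1 * y)%g = f x by rewrite mulgKV.
    by rewrite fM // => <- ->.
  split=> [x Gx|u v]; first by have [Gr cr] := repP (cl x); apply: fe; rewrite ?cr.
  have [Gu cu] := repP u; have [Gv cv] := repP v; have [Gw cw] := repP (u + v).
  by rewrite -fM //; apply: fe; rewrite ?clM ?cu ?cv //; exact: GM.
pose chi i v := basis_sign (rep v) i; pose beta i v := b (rep v) i.
have chiP i := factor (basis_sign^~ i) (fun x y => @basis_signM x y i)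
  (fun x => @basis_sign_lattice x i).
have betaP i := factor (b^~ i) (fun x y => @bM x y i) (fun x => @b_lat x i).
have chiE x : Gamma x -> chi ^~ (cl x) = basis_sign x.
  by move=> Gx; apply/funext => i; rewrite /chi -(chiP i).1.
have tau_surj v (t : 'cV[R]_m) : (forall i, half_int (beta i v) (t i 0)) ->
    exists x, [/\ Gamma x, cl x = v & tau x = t].
  move=> ht; have [Gv cv] := repP v.
  have hz i : exists z : int, t i 0 - tau (rep v) i 0 = z%:~R.
    have := half_intD (ht i) (half_intN (hb _ i Gv)).
    by rewrite /beta addbb => -[z ->]; exists z; rewrite mul0r addr0.
  have [z ez] := choice hz; have [y yl ey] := basis_shift_surj (\col_i z i).
  have [Gy _] := yl; exists (y * rep v)%g; split; first exact: GM.
    by rewrite clM // cv (cl_lat Gy).2 // add0r.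
  rewrite tM // sgn_mx0; last by move=> i; exact: basis_sign_lattice.
  rewrite mul1mx (tau_lat _ yl) ey; apply/colP => i; rewrite mxE.
  have -> : (map_mx intr (\col_i z i) : 'cV[R]_m) i 0 = t i 0 - tau (rep v) i 0.
    by rewrite ez 2!mxE.
  by rewrite addrC subrK.
exists chi, beta; split.
- exists tau; split=> //; first by move=> x y Gx Gy; rewrite chiE // tM.
  by move=> x i Gx; rewrite /beta -(betaP i).1 //; exact: hb.
- by move=> i; exact: (chiP i).2.
- by move=> i; exact: (betaP i).2.
- move=> v v0; apply: contrapT => nov; move/eqP: v0; apply.
  (* If v is covered by no coordinate, its lift with shifts exactly beta/2 squares to 1, so it is
     trivial by torsion-freeness. *)
  pose t : 'cV[R]_m := \col_i ((beta i v)%:R / 2).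
  have ht i : half_int (beta i v) (t i 0) by exists 0; rewrite mxE add0r.
  have [x [Gx cx tx]] := tau_surj v t ht.
  have x2 : (x * x)%g = 1%g.
    have xl := sqr_lattice Gx; apply: basis_shift_inj => //; rewrite -tau_lat // tM // tx.
    apply/colP => i; rewrite mxE sgn_mxE -chiE // cx !mxE.
    have : ~~ (~~ chi i v && beta i v) by apply/negP => h; apply: nov; exists i.
    by case: (chi i v); case: (beta i v) => //= _; rewrite ?expr0 ?expr1; lra.
  by rewrite -cx (Gtf (m := 2) Gx).
move=> v v0; apply: contrapT => nov; move/eqP: v0; apply.
have [Gv cv] := repP v; rewrite -cv; apply: basis_sign_faithful => // i.
by apply/negbTE/negP => ci; apply: nov; exists i.
Qed.

End Normalization.

(** N is the kernel of the map onto the diagonal group. It lies in the lattice: an element of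
    nonzero class is covered by some i, so its i-th shift lies in Z + 1/2 and is nonzero. *)
Lemma realized_quotient (R : realType) n k r (Gamma : set (Isom R n))
    (cl : Isom R n -> 'rV['F_2]_k) (chi beta : 'I_r -> 'rV['F_2]_k -> bool) :
  subgroup Gamma ->
  (forall x y, Gamma x -> Gamma y -> cl (x * y)%g = cl x + cl y) ->
  (forall x, Gamma x -> (cl x = 0 <-> lattice Gamma x)) ->
  realizes Gamma cl chi beta ->
  (forall i, bool_hom (chi i)) -> (forall i, bool_hom (beta i)) ->
  covering chi beta -> diagonal_holonomy (diag_group (R := R) chi beta) ->
  exists N : set (Isom R n), [/\ subgroup N, N `<=` lattice Gamma, normal_in N Gamma &
    diagonal_bieberbach_quotient Gamma N r].
Proof.
move=> GG clM cl_lat [tau [tM th ts]] chiD betaD cov dh.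
pose f x : Isom R r := sgn_isom (chi ^~ (cl x)) (tau x).
have fM x y : Gamma x -> Gamma y -> f (x * y)%g = (f x * f y)%g.
  move=> Gx Gy; apply: isom_eq; rewrite /= ?tM // sgn_mxM clM //.
  by congr sgn_mx; apply/funext => i; rewrite chiD.
have fD x : Gamma x -> diag_group chi beta (f x).
  by move=> Gx; exists (cl x); split=> // i; exact: th.
have f_surj y : diag_group chi beta y -> exists2 x, Gamma x & f x = y.
  move=> [v [yv hy]]; have [x [Gx cx tx]] := ts v y.2 hy.
  by exists x => //; apply: isom_eq; rewrite //= cx yv.
have [sN nN iso] := kernel_isomorphic GG fM fD f_surj.
exists (Gamma `&` [set x | f x = 1%g]); split=> //.
  move=> x [Gx /= fx]; apply/(cl_lat x Gx)/eqP/negP => /negP /cov[i /andP[_ bi]].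
  have := th x i Gx; rewrite bi; have -> : tau x i 0 = 0.
    by have /colP/(_ i) := congr1 (fun y : Isom R r => y.2) fx; rewrite mxE.
  by move/half_int_true_neq0; rewrite eqxx.
exists (diag_group chi beta); split=> //; first exact: diag_group_bieberbach.
exact: diagonal_holonomy_type (diag_group_crystallographic chiD betaD) dh.
Qed.

Lemma vasquez_bound_quadratic (R : realType) k : (1 < k)%N ->
  vasquez_bound R [set: 'rV['F_2]_k]%G ('C(k.+1, 2) + (3 < k)).
Proof.
move=> k1 n Gamma [[GG Gdis Gcomp] Gtf] [m [Delta [[DD Ddis _] [E basE holE] [phi pb phiM]]]] hol.
have latG : lattice Gamma `<=` Gamma by move=> x [].
have [cl clM [_ clN cl_surj']] :=
  isomorphic_quotient_hom GG (lattice_subgroup GG) latG (lattice_normal GG) hol.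
have cl_surj v : exists2 x, Gamma x & cl x = v by apply: cl_surj'; rewrite /= inE.
have [chi [beta [real chiD betaD cov fth]]] :=
  normal_form GG Gcomp Gtf DD Ddis basE holE pb phiM clM clN cl_surj.
have [r [chi' [beta' [rle [real' chiD' betaD'] cov' fth']]]] :=
  reduction (P := fun r => @realizes R n k Gamma cl r)
    (@realizes_restrict R n k Gamma cl) (@realizes_merge R n k Gamma cl)
    k1 (And3 real chiD betaD) cov fth.
have dh : diagonal_holonomy (diag_group (R := R) chi' beta').
  case: fth' => [fth'|[chi0 surj]]; first exact: diag_group_diagonal_holonomy.
  exact: diag_group_diagonal_holonomy0.
have [N [sN Nl nN quo]] := realized_quotient GG clM clN real' chiD' betaD' cov' dh.
by exists N; split=> //; exists r.
Qed.

(** The stated upper bound times 8, which clears the fraction occurring for k = 2. Equality holds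
    for k = 3 and k = 4, so induction starts at 4. *)
Lemma bin2_le_pow k : (1 < k)%N -> (8 * ('C(k.+1, 2) + (3 < k)) <= 5 * 2 ^ k + 8)%N.
Proof.
case: k => [|[|[|[|k]]]] // _.
elim: k => [|k IH] //; rewrite binS bin1 expnS.
have pow : (2 ^ k.+4 = 8 * 2 ^ k.+1)%N by rewrite -[8%N]/(2 ^ 3)%N -expnD.
have : (k.+1 < 2 ^ k.+1)%N by exact: ltn_expl.
by move: IH; rewrite pow /=; lia.
Qed.

Theorem theoremA (R : realType) (k : nat) (k_ge2 : (2 <= k)%N) :
  exists2 d : nat, is_diagonal_vasquez R [set: 'rV['F_2]_k]%G d &
    d%:R <= 5%:R * 2%:R ^ (k%:Z - 3) + 1 :> rat /\
    (if odd k then k%:R * (k + 1)%:R / 2%:R - 1 else k%:R * (k + 1)%:R / 2%:R)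
      <= d%:R :> rat.
Proof.
have ub := vasquez_bound_quadratic (R := R) k_ge2.
have ex : exists d, `[< vasquez_bound R [set: 'rV['F_2]_k]%G d >].
  by exists ('C(k.+1, 2) + (3 < k))%N; apply/asboolP.
case: (ex_minnP ex) => d /asboolP bd dmin.
have dU : (d <= 'C(k.+1, 2) + (3 < k))%N by apply: dmin; apply/asboolP.
exists d; first by split=> // d' bd'; apply: dmin; apply/asboolP.
have binE : k%:R * (k + 1)%:R / 2%:R = 'C(k.+1, 2)%:R :> rat.
  have := mul_bin_diag k.+1 1; rewrite /= bin1 => e.
  have := congr1 (fun i : nat => i%:R : rat) e; rewrite !natrM -addn1 => {}e.
  by rewrite [_%:R * _%:R]mulrC e mulrAC mulfV ?mul1r.
split.
  have le8 : (8 * d <= 5 * 2 ^ k + 8)%N.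
    by apply: leq_trans (bin2_le_pow k_ge2); rewrite leq_mul2l dU orbT.
  have -> : 2%:R ^ (k%:Z - 3) = 2%:R ^+ k / 8%:R :> rat.
    by rewrite expfzDr // exprnP.
  have : (8 * d)%:R <= (5 * 2 ^ k + 8)%:R :> rat by rewrite ler_nat.
  by rewrite natrM natrD natrM natrX; set p := _ ^+ k; lra.
(* Only k = 3 needs the separate family; for other odd k the pairs give one more than is claimed. *)
rewrite !binE; have [k3|k3] := eqVneq k 3%N.
  have : vasquez_bound R [set: 'rV['F_2]_3]%G d by rewrite -k3.
  move/vasquez_bound_rank3; rewrite k3 (_ : 'C(4, 2) = 6%N) //= -(ler_nat rat).
  by lra.
have := vasquez_bound_pairs k_ge2 k3 bd; rewrite -(ler_nat rat) => h.
by case: ifP => _ //; apply: le_trans h; rewrite lerBlDr lerDl.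
Qed.
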